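(* Let $H = H(O,\vec p)$ be the standard hereditary order. The group $\mathrm{Aut}(H)$ of all ring automorphisms of $H$ is generated by the following classes of elements: (a) arbitrary inner automorphisms of $H$; (b) the automorphisms induced (entrywise) by ring automorphisms of $O$; (c) the automorphism $\mathrm{Ad}_\varrho: x\mapsto \varrho x\varrho^{-1}$. The corresponding induced automorphisms of $\bar H = H/\mathrm{rad}(H)\cong M_{p_1}(\bar O)\times\dots\times M_{p_r}(\bar O)$ are the following: (a) arbitrary inner automorphisms of $\bar H$; (b) the automorphisms induced (entrywise) by the ring automorphisms of $\bar O$ which belong to the image of the canonical homomorphism $\mathrm{Aut}(O)\to\mathrm{Aut}(\bar O)$; (c) the twisted cyclic shift $$(z_1,\dots,z_t,\dots,z_{r-t+1},\dots,z_r)\mapsto(\kappa(z_{r-t+1}),\dots,\kappa(z_r),z_1,\dots,z_t,\dots,z_{r-t}).$$ Moreover, if another uniformizing element $\widetilde w\in I$ is chosen, then $\widetilde w=uw$ for some $u\in O^\ast$, and the corresponding twisted cyclic shift is related with the original one by an inner automorphism.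
   Context: $R$ is a complete discrete valuation ring with quotient field $K$, $F$ is a finite-dimensional skew field with center $K$, $O$ is the (unique) maximal $R$-order in $F$, $I=\mathrm{rad}(O)$, $\bar O = O/I$ (a skew field), and $w\in I$ is a chosen uniformizing element, i.e. $I = wO=Ow$. $\mathrm{Aut}$ denotes the group of ring automorphisms. For $r\in\mathbb{N}$ and $\vec p=(p_1,\dots,p_r)\in\mathbb{N}^r$ (positive integers) put $p = p_1+\dots+p_r$. The order $H(O,\vec p)\subset M_p(F)$ consists of all block matrices $(x_{ij})_{1\le i,j\le r}$, where the block $x_{ij}$ has size $p_i\times p_j$, with entries in $O$ if $i\ge j$ and entries in $I$ if $i<j$. The isomorphism $\bar H\cong\prod_i M_{p_i}(\bar O)$ sends the class of $(x_{ij})$ to $(\bar x_{11},\dots,\bar x_{rr})$. Let $1\le t\le r$ be minimal such that $t\mid r$ and $\vec p = (p_1,\dots,p_t;\dots;p_1,\dots,p_t)$. Put $q = p_1+\dots+p_t$ and $l=r/t$. The matrix $\varrho\in M_p(F)$ is the $l\times l$ block matrix with $q\times q$ blocks $$\varrho=\begin{pmatrix}0&0&\dots&0&w\mathbf 1_q\\ \mathbf 1_q&0&\dots&0&0\\ 0&\mathbf 1_q&\dots&0&0\\ \vdots&\vdots&\ddots&\vdots&\vdots\\ 0&0&\dots&\mathbf 1_q&0\end{pmatrix}$$ (for $l=1$, $\varrho=w\mathbf 1_p$); it satisfies $\varrho H\varrho^{-1}=H$. $\kappa\in\mathrm{Aut}(\bar O)$ is the automorphism induced by $\mathrm{Ad}_w: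 O\to O$, $a\mapsto waw^{-1}$; it acts entrywise on matrices over $\bar O$. *)

(* Defs.v *)
From HB Require Import structures.
From mathcomp Require Import all_boot all_order all_algebra all_field.
From mathcomp Require Import generic_quotient ring_quotient.
From mathcomp Require Import boolp classical_sets.

Set Implicit Arguments.
Unset Strict Implicit.
Unset Printing Implicit Defensive.

Import GRing.Theory.
Local Open Scope classical_set_scope.
Local Open Scope ring_scope.
Local Open Scope quotient_scope.
Import tagnat.

Section Generalities.
Variable A : pzRingType.
Implicit Types (f g : A -> A) (J : set A).

Definition mutual_inverse (u v : A) := u * v = 1 /\ v * u = 1.

Definition invertible (u : A) := exists v, mutual_inverse u v.

Definition ring_aut f := [/\ zmod_morphism f, monoid_morphism f & bijective f].

Definition inner f :=
  exists u v, mutual_inverse u v /\ forall x, f x = u * x * v.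

Inductive generated (S : set (A -> A)) : (A -> A) -> Prop :=
| gen_id : generated S id
| gen_mem f : S f -> generated S f
| gen_comp f g : generated S f -> generated S g -> generated S (f \o g)
| gen_inv f g : generated S f -> cancel f g -> cancel g f -> generated S g.

Definition left_ideal J :=
  [/\ J 0, forall x y, J x -> J y -> J (x + y) & forall a x, J x -> J (a * x)].

Definition maximal_left_ideal J :=
  [/\ left_ideal J, ~ J 1 &
      forall J', left_ideal J' -> J `<=` J' -> ~ J' 1 -> J' `<=` J].

Definition rad : {pred A} :=
  fun x => `[< forall J, maximal_left_ideal J -> J x >].

Lemma radP x : reflect (forall J, maximal_left_ideal J -> J x) (x \in rad).
Proof. exact: asboolP. Qed.

Lemma rad_zmod_closed : zmod_closed rad.
Proof.
split; first by apply/radP => J [[]].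
move=> x y /radP xJ /radP yJ; apply/radP => J mJ.
case: (mJ) => -[_ JD JM] _ _; apply: JD; first exact: xJ.
by rewrite -mulN1r; apply: JM; apply: yJ.
Qed.

HB.instance Definition _ := GRing.isZmodClosed.Build A rad rad_zmod_closed.

Lemma radMl a x : x \in rad -> a * x \in rad.
Proof.
move=> /radP xJ; apply/radP => J mJ; case: (mJ) => -[_ _ JM] _ _.
by apply: JM; apply: xJ.
Qed.

(* For a maximal left ideal [J] and [a] outside [J], the left ideal
   [{y | y * a \in J}] is again maximal. *)
Lemma radMr a x : x \in rad -> x * a \in rad.
Proof.
move=> /radP xJ; apply/radP => J mJ; case: (mJ) => -[J0 JD JM] J1 Jmax.
have [Ja|nJa] := pselect (J a); first exact: JM.
suff: maximal_left_ideal [set y | J (y * a)] by move/xJ.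
split; [split | |] => /=.
- by rewrite mul0r.
- by move=> y z; rewrite mulrDl; exact: JD.
- by move=> b y; rewrite -mulrA; exact: JM.
- by rewrite mul1r.
move=> J' [J'0 J'D J'M] sub nJ'1 y J'y /=; apply: contrapT => nJya.
set N : set A := fun z => exists j j', J j /\ J' j' /\ z = j + j' * a.
have lN : left_ideal N.
  split.
  - by exists 0, 0; rewrite mul0r addr0.
  - move=> _ _ [j1 [k1 [Jj1 [Jk1 ->]]]] [j2 [k2 [Jj2 [Jk2 ->]]]].
    exists (j1 + j2), (k1 + k2); split; first exact: JD.
    by split; [exact: J'D | rewrite mulrDl addrACA].
  - move=> b _ [j1 [k1 [Jj1 [Jk1 ->]]]]; exists (b * j1), (b * k1).
    by split; [exact: JM | split; [exact: J'M | rewrite mulrDr mulrA]].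
have [[j [j' [Jj [J'j' e]]]]|nNa] := pselect (N a).
  apply: nJ'1; rewrite -[1](subrK j'); apply: J'D => //; apply: sub => /=.
  by rewrite mulrBl mul1r {1}e addrK.
apply: nJya; apply: (Jmax N lN).
- by move=> j Jj; exists j, 0; rewrite mul0r addr0.
- by move=> N1; apply: nNa; case: lN => _ _ /(_ a 1 N1); rewrite mulr1.
- by exists 0, y; rewrite add0r.
Qed.

(* The library only makes quotients of commutative rings into rings. *)
Definition rad_quot : Type := {ideal_quot rad}.

HB.instance Definition _ := GRing.Zmodule.on rad_quot.

Definition modrad (x : A) : rad_quot := \pi_({ideal_quot rad}) x.

Lemma modrad_eq x y : modrad x = modrad y <-> x - y \in rad.
Proof.
by rewrite Quotient.idealrBE; split=> /eqP.
Qed.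

Lemma modrad_repr (y : rad_quot) : modrad (repr y) = y.
Proof. exact: reprK. Qed.

Lemma modradD x y : modrad (x + y) = modrad x + modrad y.
Proof. by rewrite /modrad !piE. Qed.

Definition rad_quot_mul (y z : rad_quot) := modrad (repr y * repr z).

Lemma modradM x y : modrad (x * y) = rad_quot_mul (modrad x) (modrad y).
Proof.
apply/modrad_eq.
rewrite -[x * y](subrK (x * repr (modrad y))) -addrA -mulrBr -mulrBl.
by apply: rpredD; [apply: radMl | apply: radMr];
  apply/modrad_eq; rewrite modrad_repr.
Qed.

Lemma rad_quot_mulA : associative rad_quot_mul.
Proof.
move=> x y z; rewrite -[x]modrad_repr -[y]modrad_repr -[z]modrad_repr.
by rewrite -!modradM mulrA.
Qed.

Lemma rad_quot_mul1 : left_id (modrad 1) rad_quot_mul.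
Proof. by move=> x; rewrite -[x]modrad_repr -modradM mul1r. Qed.

Lemma rad_quot_mulr1 : right_id (modrad 1) rad_quot_mul.
Proof. by move=> x; rewrite -[x]modrad_repr -modradM mulr1. Qed.

Lemma rad_quot_mulDl : left_distributive rad_quot_mul +%R.
Proof.
move=> x y z; rewrite -[x]modrad_repr -[y]modrad_repr -[z]modrad_repr.
by rewrite -modradD -!modradM -modradD mulrDl.
Qed.

Lemma rad_quot_mulDr : right_distributive rad_quot_mul +%R.
Proof.
move=> x y z; rewrite -[x]modrad_repr -[y]modrad_repr -[z]modrad_repr.
by rewrite -modradD -!modradM -modradD mulrDr.
Qed.

HB.instance Definition _ := GRing.Zmodule_isPzRing.Build rad_quot
  rad_quot_mulA rad_quot_mul1 rad_quot_mulr1 rad_quot_mulDl rad_quot_mulDr.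

(* The map induced by [f] on the quotient by the radical; [induced_modrad]
   shows that the choice of representatives is irrelevant. *)
Definition induced f (y : rad_quot) : rad_quot := modrad (f (repr y)).

Lemma ring_aut_rad f x : ring_aut f -> x \in rad -> f x \in rad.
Proof.
move=> [fB [f1 fM] [g fK gK]] /radP xJ; apply/radP => J.
have f0 : f 0 = 0 by rewrite -[in LHS](subrr 0) fB subrr.
have fD y z : f (y + z) = f y + f z.
  by rewrite -[z in LHS]opprK -[- z]sub0r !fB f0 sub0r opprK.
move=> [[J0 JD JM] J1 Jmax]; apply: (xJ [set y | J (f y)]).
split; [split | |] => /=; rewrite ?f0 ?f1 //.
- by move=> y z; rewrite fD; exact: JD.
- by move=> a y; rewrite fM; exact: JM.
move=> J' [J'0 J'D J'M] sub nJ'1 y J'y /=.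
have gD y1 z1 : g (y1 + z1) = g y1 + g z1 by apply: (can_inj fK); rewrite fD !gK.
have gM y1 z1 : g (y1 * z1) = g y1 * g z1 by apply: (can_inj fK); rewrite fM !gK.
apply: (Jmax [set z | J' (g z)]); last by rewrite /= fK.
- split=> /=; first by rewrite -f0 fK.
  + by move=> u v; rewrite gD; exact: J'D.
  + by move=> u v; rewrite gM; exact: J'M.
- by move=> z Jz /=; apply: sub; rewrite /= gK.
- by rewrite /= -f1 fK.
Qed.

Lemma induced_modrad f x : ring_aut f -> induced f (modrad x) = modrad (f x).
Proof.
move=> fA; apply/modrad_eq; have [fB _ _] := fA; rewrite -fB.
by apply: ring_aut_rad => //; apply/modrad_eq; rewrite modrad_repr.
Qed.

(* [w] is a uniformizing element: rad A = w A = A w. *)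
Definition uniformizer (w : A) :=
  forall x, (x \in rad <-> exists a, x = w * a) /\
            (x \in rad <-> exists a, x = a * w).

End Generalities.

Arguments rad : clear implicits.

Record subring_of (A : pzRingType) (S : subringClosed A) :=
  SubringOf { subring_val : A; subring_valP : subring_val \in S }.

Section SubringOf.
Variables (A : pzRingType) (S : subringClosed A).

HB.instance Definition _ := [isSub for @subring_val A S].
HB.instance Definition _ := [Choice of subring_of S by <:].
HB.instance Definition _ := GRing.SubChoice_isSubPzRing.Build _ _ (subring_of S)
  (GRing.subringClosedP S).

(* [f] is the automorphism x |-> g x g^-1, for a unit [g] of the big ring. *)
Definition Ad (g : A) (f : subring_of S -> subring_of S) :=
  exists g', mutual_inverse g g' /\ forall x, val (f x) = g * val x * g'.

End SubringOf.

Section Orders.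

Definition discrete_valuation_ring (R : idomainType) :=
  [/\ forall J : set R, left_ideal J -> exists a, J = [set x | exists b, x = b * a],
      forall x y : R, x \isn't a GRing.unit -> y \isn't a GRing.unit ->
        x + y \isn't a GRing.unit &
      exists x : R, x != 0 /\ x \isn't a GRing.unit].

(* Completeness for the topology given by the powers of the maximal ideal
   (pi), where "c is divisible by pi ^+ n" is spelled out. *)
Definition adically_complete (R : idomainType) :=
  forall pi : R, (forall x : R, x \isn't a GRing.unit <-> exists c, x = c * pi) ->
  forall u : nat -> R,
    (forall n, exists N, forall m k, (N <= m)%N -> (N <= k)%N ->
       exists c, u m - u k = c * pi ^+ n) ->
    exists l, forall n, exists N, forall m, (N <= m)%N ->
       exists c, u m - l = c * pi ^+ n.

Definition quotient_field (R : idomainType) (K : fieldType)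
    (iota : {rmorphism R -> K}) :=
  injective iota /\ forall x : K, exists a b, b != 0 /\ x = iota a / iota b.

Definition skew_field (F : unitRingType) :=
  forall x : F, x != 0 -> x \is a GRing.unit.

Definition is_order (R : idomainType) (K : fieldType)
    (iota : {rmorphism R -> K}) (F : falgType K) (O : {pred F}) :=
  subring_closed O /\
  exists s : seq F,
    (forall x : F, x \in O <->
       exists c : 'I_(size s) -> R, x = \sum_i iota (c i) *: s`_i) /\
    (<<s>> = fullv)%VS.

Definition maximal_order (R : idomainType) (K : fieldType)
    (iota : {rmorphism R -> K}) (F : falgType K) (O : {pred F}) :=
  is_order iota O /\
  forall O' : {pred F}, is_order iota O' -> {subset O <= O'} -> {subset O' <= O}.

End Orders.

Section Hereditary.
Variables (F : nzRingType) (O : subringClosed F) (r : nat) (p : 'I_r -> nat).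

(* rad O as a subset of [F] *)
Definition radF : {pred F} :=
  fun x => `[< exists2 y : subring_of O, y \in rad (subring_of O) & val y = x >].

Definition hereditary : {pred 'M[F]_(\sum_i p i)} :=
  fun x => [forall i : 'I_r, forall j : 'I_r, forall a, forall b,
    if (j <= i)%N then submxblock x i j a b \in O
                  else submxblock x i j a b \in radF].

Lemma radF_sub : {subset radF <= O}.
Proof. by move=> x /asboolP [y _ <-]; exact: (valP y). Qed.

Lemma radF0 : 0 \in radF.
Proof. by apply/asboolP; exists 0; [exact: rpred0 | exact: rmorph0]. Qed.

Lemma radFB x y : x \in radF -> y \in radF -> x - y \in radF.
Proof.
move=> /asboolP [a ar <-] /asboolP [b br <-]; apply/asboolP.
by exists (a - b); [exact: rpredB | exact: rmorphB].
Qed.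

Lemma radFD x y : x \in radF -> y \in radF -> x + y \in radF.
Proof.
move=> xr yr; rewrite -[y]opprK; apply: radFB => //.
by rewrite -sub0r; apply: radFB => //; exact: radF0.
Qed.

Lemma radFMl x y : x \in O -> y \in radF -> x * y \in radF.
Proof.
move=> xO /asboolP [b br <-]; apply/asboolP.
by exists (SubringOf xO * b); [exact: radMl | exact: rmorphM].
Qed.

Lemma radFMr x y : x \in radF -> y \in O -> x * y \in radF.
Proof.
move=> /asboolP [b br <-] yO; apply/asboolP.
by exists (b * SubringOf yO); [exact: radMr | exact: rmorphM].
Qed.

Lemma hereditaryP (x : 'M[F]_(\sum_i p i)) :
  reflect (forall s t, if (sig1 t <= sig1 s)%N then x s t \in O
                       else x s t \in radF)
          (x \in hereditary).
Proof.
apply: (iffP idP) => [xH s t | xH].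
  move: xH => /forallP/(_ (sig1 s))/forallP/(_ (sig1 t)).
  by move=> /forallP/(_ (sig2 s))/forallP/(_ (sig2 t)); rewrite !mxE !sig2K.
apply/forallP => i; apply/forallP => j; apply/forallP => a; apply/forallP => b.
by have := xH (Rank i a) (Rank j b); rewrite !Rank1K !mxE.
Qed.

Lemma hereditary_closed : subring_closed hereditary.
Proof.
split.
- apply/hereditaryP => s t; rewrite mxE; case: leqP => [_|lt_st].
    by rewrite rpredMn ?rpred1.
  by rewrite (_ : s == t = false) ?radF0 //; apply/eqP => e; rewrite e ltnn in lt_st.
- move=> x y /hereditaryP xH /hereditaryP yH; apply/hereditaryP => s t.
  by move: (xH s t) (yH s t); rewrite !mxE; case: leqP => _; [exact: rpredB | exact: radFB].
move=> x y /hereditaryP xH /hereditaryP yH; apply/hereditaryP => s t.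
have xO u v : x u v \in O by move: (xH u v); case: leqP => // _ /radF_sub.
have yO u v : y u v \in O by move: (yH u v); case: leqP => // _ /radF_sub.
rewrite mxE; case: leqP => [_|lt_st]; first by apply: rpred_sum => k _; exact: rpredM.
apply: (big_ind (fun z => z \in radF)) => [||k _]; [exact: radF0 | exact: radFD |].
have [le_ks|lt_sk] := leqP (sig1 k) (sig1 s).
  apply: radFMl => //; have := yH k t.
  by rewrite leqNgt (leq_ltn_trans le_ks lt_st).
by apply: radFMr => //; have := xH s k; rewrite leqNgt lt_sk.
Qed.

HB.instance Definition _ :=
  GRing.isSubringClosed.Build _ hereditary hereditary_closed.

End Hereditary.

Arguments radF {F} O _.
Arguments hereditary {F} O {r} p _.

Notation Obar O := (rad_quot (subring_of O)).
Notation Hord O p := (subring_of (hereditary O p)).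

Definition block_prod (B : pzRingType) (r : nat) (p : 'I_r -> nat) :=
  forall i, 'M[B]_(p i).

Section BlockProd.
Variables (B : pzRingType) (r : nat) (p : 'I_r -> nat).
Notation P := (block_prod B p).

HB.instance Definition _ := gen_eqMixin P.
HB.instance Definition _ := gen_choiceMixin P.

Let zero : P := fun i => 0.
Let opp (x : P) : P := fun i => - x i.
Let add (x y : P) : P := fun i => x i + y i.
Let one : P := fun i => 1.
Let mul (x y : P) : P := fun i => x i * y i.

Fact block_addA : associative add.
Proof. by move=> x y z; apply: functional_extensionality_dep => i; exact: addrA. Qed.
Fact block_addC : commutative add.
Proof. by move=> x y; apply: functional_extensionality_dep => i; exact: addrC. Qed.
Fact block_add0 : left_id zero add.
Proof. by move=> x; apply: functional_extensionality_dep => i; exact: add0r. Qed.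
Fact block_addN : left_inverse zero opp add.
Proof. by move=> x; apply: functional_extensionality_dep => i; exact: addNr. Qed.

HB.instance Definition _ :=
  GRing.isZmodule.Build P block_addA block_addC block_add0 block_addN.

Fact block_mulA : associative mul.
Proof. by move=> x y z; apply: functional_extensionality_dep => i; exact: mulrA. Qed.
Fact block_mul1 : left_id one mul.
Proof. by move=> x; apply: functional_extensionality_dep => i; exact: mul1r. Qed.
Fact block_mulr1 : right_id one mul.
Proof. by move=> x; apply: functional_extensionality_dep => i; exact: mulr1. Qed.
Fact block_mulDl : left_distributive mul +%R.
Proof. by move=> x y z; apply: functional_extensionality_dep => i; exact: mulrDl. Qed.
Fact block_mulDr : right_distributive mul +%R.
Proof. by move=> x y z; apply: functional_extensionality_dep => i; exact: mulrDr. Qed.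

HB.instance Definition _ := GRing.Zmodule_isPzRing.Build P
  block_mulA block_mul1 block_mulr1 block_mulDl block_mulDr.

End BlockProd.

Section StandardOrder.
Variables (F : nzRingType) (O : subringClosed F) (r : nat) (p : 'I_r -> nat).

(* Only used on elements of [O]; elsewhere the value is the junk class 0. *)
Definition residue (x : F) : Obar O := modrad (insubd (0 : subring_of O) x).

Definition diag_residue (x : Hord O p) : block_prod (Obar O) p :=
  fun i => map_mx residue (submxblock (val x) i i).

Definition theta (y : rad_quot (Hord O p)) : block_prod (Obar O) p :=
  diag_residue (repr y).

Definition entrywise (sigma : subring_of O -> subring_of O)
    (f : Hord O p -> Hord O p) :=
  forall (x : Hord O p) s t (a : subring_of O),
    val x s t = val a -> val (f x) s t = val (sigma a).

Definition period (t : nat) :=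
  [/\ (0 < t)%N, (t %| r)%N & forall i j : 'I_r, (i = j %[mod t])%N -> p i = p j].

Definition minimal_period (t : nat) :=
  period t /\ forall t', period t' -> (t <= t')%N.

Definition rho (t : nat) (w : F) : 'M[F]_(\sum_i p i) :=
  let q := (\sum_(i < r | (i < t)%N) p i)%N in
  let l := (r %/ t)%N in
  \matrix_(m, n)
    if (m %% q != n %% q)%N then 0
    else if (m %/ q == (n %/ q).+1)%N then 1
    else if (m %/ q == 0)%N && (n %/ q == l.-1)%N then w
    else 0.

(* The automorphism of O / rad O induced by a |-> w a w^-1. *)
Definition is_kappa (w : subring_of O) (kappa : Obar O -> Obar O) :=
  exists f, [/\ ring_aut f, Ad (val w) f & kappa = induced f].

Lemma shift_subproof (t : nat) (i : 'I_r) : ((i + (r - t)) %% r < r)%N.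
Proof. by rewrite ltn_pmod // (leq_ltn_trans _ (ltn_ord i)). Qed.

Definition shift_index (t : nat) (i : 'I_r) : 'I_r := Ordinal (shift_subproof t i).

(* When [t] is a period, [p (shift_index t i) = p i], so that [conform_mx] is
   a mere cast and its default value [0] is never used. *)
Definition twisted_shift (B : pzRingType) (t : nat) (kappa : B -> B)
    (z : block_prod B p) : block_prod B p :=
  fun i => let z' := conform_mx (0 : 'M_(p i)) (z (shift_index t i)) in
           if (i < t)%N then map_mx kappa z' else z'.

End StandardOrder.

(* Main.v *)
Require Import Defs.
From mathcomp Require Import all_boot all_order all_algebra all_field.
From mathcomp Require Import boolp classical_sets.
From mathcomp Require Import ring zify.

Set Implicit Arguments.
Unset Strict Implicit.
Unset Printing Implicit Defensive.

Import GRing.Theory.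
Local Open Scope classical_set_scope.
Local Open Scope ring_scope.
Import tagnat.

(** Completeness of [R] is used only to see that [O] is local: every element of
    [O] yields an element idempotent modulo the maximal ideal of [R], which lifts
    to an idempotent of the skew field, that is, to 0 or 1. So the nonunits of [O]
    form [wO = Ow], and exponents of [w] serve as valuations.

    The diagonal idempotents of [H] have local corner rings [O], so by the
    Krull-Schmidt exchange argument an automorphism [f] of [H] permutes them after
    composition with an inner one. Then [f] sends [x] to [g sigma(x) g^-1] for an
    automorphism [sigma] of [O] and a monomial matrix [g], and comparing valuations
    shows that the induced permutation of the blocks is a rotation. It preserves
    the block sizes, hence is a rotation by a multiple of the minimal period [t];
    dividing by a power of [Ad rho] leaves a [g] that is a unit of [H]. *)

(** * Orders over a complete discrete valuation ring are local *)

(** Locality of [O] has to be proved without commutativity. What replaces it is that [R] is central: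
    left multiplication by an element of [O] acts on the generators through a matrix over [R], so
    determinants and Cayley-Hamilton are available. The rotation comes from counting exponents. The
    entries of [H] at (s, t) form [W ^+ [s < t] * O], where a bracket compares blocks and is 0 or 1.
    An automorphism that permutes the diagonal idempotents by [pi] maps them onto the entries at (pi
    s, pi t). After rescaling by the factors [u s], the two families of exponents agree up to a
    coboundary; with [s0] in the first block this reads [pi s < pi t] + [pi t < pi s0] =
    [pi s < pi s0] + [s < t]. In other words, [pi] respects the cyclic order of the blocks. The
    minimal period enters through Bezout: sizes invariant under shifts by b and by t are invariant
    under the shift by gcd(t, b), so t divides b. *)

Lemma det_sub1Z (R : comNzRingType) n (C : 'M[R]_n) (a : R) :
  exists e, \det (1%:M - a *: C) = 1 + a * e.
Proof.
(* As a function of [a] the determinant is a polynomial with value 1 at 0, so ['X] divides its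
   difference from 1. *)
pose P : {poly R} := \det (1%:M - 'X *: map_mx polyC C).
have evP x : P.[x] = \det (1%:M - x *: C).
  rewrite -/(horner_eval x P) /P -det_map_mx; congr (\det _).
  apply/matrixP => i j; rewrite !mxE -[LHS]/(_.[x]).
  by rewrite hornerD hornerN hornerM hornerX hornerC hornerMn hornerC.
have /factor_theorem [Q PQ] : root (P - 1) 0.
  by rewrite /root hornerD hornerN evP scale0r subr0 det1 hornerC subrr.
exists Q.[a]; rewrite -evP -[P](subrK 1) PQ hornerD hornerM hornerXsubC hornerC.
by rewrite subr0 addrC mulrC.
Qed.

Section CompleteOrder.
Variables (R : idomainType) (K : fieldType) (iota : {rmorphism R -> K}).
Hypotheses (hR : discrete_valuation_ring R) (cR : adically_complete R).
Hypothesis hK : quotient_field iota.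
Variables (F : falgType K) (O : subringClosed F).
Hypotheses (hF : skew_field F) (hO : is_order iota O).

(** [J] embeds [R] in the center of [F]; products with [J a] replace scaling by [iota a], so that
    matrices over [R] can be mapped into [F]. *)
Variable J : {rmorphism R -> F}.
Hypothesis JE : forall a x, J a * x = iota a *: x.

Lemma J_comm a (x : F) : J a * x = x * J a.
Proof. by rewrite -[J a]mulr1 JE -scalerAr mulr1 -scalerAl mul1r. Qed.

Lemma J_inj : injective J.
Proof.
move=> a b /eqP; rewrite -[J a]mulr1 -[J b]mulr1.
rewrite !JE -subr_eq0 -scalerBl scaler_eq0 oner_eq0 orbF subr_eq0 => /eqP.
exact: hK.1.
Qed.

Lemma exists_residue_generator : exists2 pi : R, pi != 0 &
  forall x : R, x \isn't a GRing.unit <-> exists c, x = c * pi.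
Proof.
have [pid loc [x0 [nz0 nu0]]] := hR.
have lid : left_ideal [set x : R | x \isn't a GRing.unit].
  split=> /=; first by rewrite unitr0.
  - exact: loc.
  - by move=> a x; apply: contra; rewrite unitrM => /andP[].
have [pi e] := pid _ lid.
have nuP (x : R) : x \isn't a GRing.unit <-> exists c, x = c * pi.
  by have := congr1 (fun A : set R => A x) e; rewrite /= => ->.
exists pi => //; apply: contra nz0 => /eqP pi0.
by have /nuP[c ->] := nu0; rewrite pi0 mulr0.
Qed.

Variable pi : R.
Hypothesis pi_neq0 : pi != 0.
Hypothesis piP : forall x : R, x \isn't a GRing.unit <-> exists c, x = c * pi.

Lemma unit_add1 e : 1 + pi * e \is a GRing.unit.
Proof.
have [_ loc _] := hR; apply/negPn/negP => nu.
have: 1 \isn't a @GRing.unit R; last by rewrite unitr1.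
rewrite -[1](addrK (pi * e)); apply: loc => //.
by apply/piP; exists (- e); rewrite mulNr mulrC.
Qed.

Lemma order_span : exists n (S : 'cV[F]_n.+1), forall x, x \in O <->
  exists c : 'rV[R]_n.+1, x = (map_mx J c *m S) 0 0.
Proof.
(* A zero is prepended to the generators to make their number a successor, the matrix size for which
   Cayley-Hamilton is applied below. *)
have [_ [s [sP _]]] := hO; exists (size s), (\col_i (0 :: s)`_i) => x.
rewrite sP; split=> [[c ->]|[c ->]].
  exists (row_mx 0 (\row_i c i) : 'rV_(1 + size s)).
  rewrite mxE big_ord_recl !mxE mulr0 add0r; apply: eq_bigr => i _.
  rewrite !mxE -JE; congr (J _ * _).
  by case: splitP => [[[]] //|k /= [/val_inj ->]]; rewrite mxE.
exists (fun i => c 0 (lift ord0 i)); rewrite mxE big_ord_recl !mxE mulr0 add0r.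
by apply: eq_bigr => i _; rewrite !mxE JE.
Qed.

Lemma scale_map_mx m n (C : 'M[R]_(m, n)) (T : 'cV[F]_n) (x : F) :
  map_mx J C *m (x *: T) = x *: (map_mx J C *m T).
Proof.
apply/matrixP => i j; rewrite !mxE mulr_sumr; apply: eq_bigr => k _.
by rewrite !mxE !mulrA J_comm.
Qed.

Section Span.
Variables (n' : nat) (S : 'cV[F]_n'.+1).
Local Notation n := n'.+1.
Hypothesis SP : forall x,
  x \in O <-> exists c : 'rV[R]_n, x = (map_mx J c *m S) 0 0.

Lemma map_mx_span m (C : 'M[R]_(m, n)) i : (map_mx J C *m S) i 0 \in O.
Proof.
apply/SP; exists (row i C); rewrite !mxE; apply: eq_bigr => j _.
by rewrite !mxE.
Qed.

Lemma J_order a : J a \in O.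
Proof.
have /SP[c e] := rpred1 O; apply/SP; exists (a *: c).
rewrite map_mxZ -scalemxAl mxE -e mulr1 //.
Qed.

Lemma mul_order_mx x : x \in O -> exists C : 'M[R]_n, x *: S = map_mx J C *m S.
Proof.
move=> xO; have SO i : S i 0 \in O.
  by have := map_mx_span 1%:M i; rewrite map_mx1 mul1mx.
have H i : exists c : 'rV[R]_n, x * S i 0 = (map_mx J c *m S) 0 0.
  by apply/SP; rewrite rpredM.
have [c cP] := choice H; exists (\matrix_i c i).
apply/matrixP => i j; rewrite ord1 mxE cP !mxE; apply: eq_bigr => k _.
by rewrite !mxE.
Qed.

(* Determinant trick: [1 - pi x] acts on generators of [O] by [1 - pi C], whose
   determinant is a unit. *)
Lemma one_sub_pi x : x \in O -> exists2 b, b \in O & (1 - J pi * x) * b = 1.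
Proof.
move=> xO; have [C xC] := mul_order_mx xO.
pose M := 1%:M - pi *: C; pose y := 1 - J pi * x.
have yM : y *: S = map_mx J M *m S.
  rewrite /y scalerBl scale1r -scalerA xC /M map_mxB map_mx1 map_mxZ mulmxBl.
  by rewrite mul1mx scalemxAl.
have [e de] := det_sub1Z C pi.
have du : \det M \is a GRing.unit by rewrite /M de unit_add1.
have e1 : S = y *: (map_mx J ((\det M)^-1 *: \adj M) *m S).
  rewrite -scale_map_mx yM mulmxA -map_mxM -scalemxAl mul_adj_mx.
  by rewrite scale_scalar_mx mulVr // map_mx1 mul1mx.
have /SP[c c1] := rpred1 O.
exists ((map_mx J (c *m ((\det M)^-1 *: \adj M)) *m S) 0 0).
  exact: map_mx_span.
rewrite -/y [RHS]c1 [in RHS]e1.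
rewrite scale_map_mx [RHS]mxE; congr (_ * _).
by rewrite map_mxM -mulmxA.
Qed.

Lemma pi_not_invertible b : b \in O -> J pi * b != 1.
Proof.
move=> bO; apply/eqP => e; have [c _ /eqP] := one_sub_pi bO.
by rewrite e subrr mul0r eq_sym oner_eq0.
Qed.


(** * Congruences modulo powers of [pi] and completeness of [O] *)

Definition pi_multiple m (x : F) := exists2 b, b \in O & x = J (pi ^+ m) * b.

Lemma pi_multipleD m x y :
  pi_multiple m x -> pi_multiple m y -> pi_multiple m (x + y).
Proof.
by move=> [b bO ->] [c cO ->]; exists (b + c); rewrite ?rpredD // mulrDr.
Qed.

Lemma pi_multipleN m x : pi_multiple m x -> pi_multiple m (- x).
Proof. by move=> [b bO ->]; exists (- b); rewrite ?rpredN // mulrN. Qed.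

Lemma pi_multipleMr m x y : pi_multiple m x -> y \in O -> pi_multiple m (x * y).
Proof. by move=> [b bO ->] yO; exists (b * y); rewrite ?rpredM // mulrA. Qed.

Lemma pi_multipleMl m x y : pi_multiple m x -> y \in O -> pi_multiple m (y * x).
Proof.
by move=> [b bO ->] yO; exists (y * b); rewrite ?rpredM // !mulrA J_comm.
Qed.

Lemma pi_multipleM m k x y :
  pi_multiple m x -> pi_multiple k y -> pi_multiple (m + k) (x * y).
Proof.
move=> [b bO ->] [c cO ->]; exists (b * c); rewrite ?rpredM // exprD rmorphM.
by rewrite -!mulrA; congr (_ * _); rewrite !mulrA J_comm.
Qed.

Lemma pi_multiple_le m k x : (k <= m)%N -> pi_multiple m x -> pi_multiple k x.
Proof.
move=> le [b bO ->]; exists (J (pi ^+ (m - k)) * b).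
  by rewrite rpredM ?J_order.
by rewrite mulrA -rmorphM -exprD subnKC.
Qed.

Lemma clear_denominators (x : F) : exists2 d, d != 0 & J d * x \in O.
Proof.
have [_ [s [sP sF]]] := hO.
have /coord_span e : x \in <<in_tuple s>>%VS by rewrite /= sF memvf.
have H i : exists ab : R * R,
    ab.2 != 0 /\ coord (in_tuple s) i x = iota ab.1 / iota ab.2.
  by have [a [b [b0 E]]] := hK.2 (coord (in_tuple s) i x); exists (a, b).
have [ab abP] := choice H.
exists (\prod_i (ab i).2); first by apply/prodf_neq0 => i _; case: (abP i).
apply/sP; exists (fun i => (ab i).1 * \prod_(j | j != i) (ab j).2).
rewrite e mulr_sumr; apply: eq_bigr => i _; have [b0 ->] := abP i.
rewrite JE scalerA; congr (_ *: _).
rewrite (bigD1 i) //= !rmorphM /=; set b := iota (ab i).2.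
have bn0 : b != 0.
  by rewrite -(rmorph0 iota); apply: contraNneq b0 => /hK.1 ->.
by rewrite mulrCA mulrA mulrAC mulrA divfK // mulrC.
Qed.

(* Otherwise the elements of [R] lying in every [pi ^+ m O] form a nonzero ideal
   [(a)], stable under division by [pi]; hence [a = pi c a]. *)
Lemma pi_multiple_eq0 z : (forall m, pi_multiple m z) -> z = 0.
Proof.
move=> zpi; apply/eqP/negPn/negP => z0.
have [d d0 dO] := clear_denominators z^-1.
have dpi m : pi_multiple m (J d).
  rewrite -[J d]mulr1 -(mulVr (hF z0)) mulrA; exact: pi_multipleMl.
have [pid _ _] := hR.
have [|a aE] := pid [set x : R | forall m, pi_multiple m (J x)].
  split=> /=.
  - by move=> m; rewrite rmorph0; exists 0; rewrite ?rpred0 ?mulr0.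
  - by move=> x y xp yp m; rewrite rmorphD; apply: pi_multipleD.
  - by move=> x y yp m; rewrite rmorphM; apply: pi_multipleMl => //; apply: J_order.
have api m : pi_multiple m (J a).
  have: [set x | exists b, x = b * a] a by exists 1; rewrite mul1r.
  by rewrite -aE; apply.
have a0 : a != 0.
  apply: contraNneq d0 => a0; have : [set x | exists b, x = b * a] d by rewrite -aE.
  by move=> [b ->]; rewrite a0 mulr0.
have [a' ea] : exists c, a = c * pi.
  apply/piP/negP => ua; have [b bO e] := api 1.
  have := pi_not_invertible (b := b * J a^-1).
  rewrite rpredM ?J_order // => /(_ isT); rewrite mulrA -[pi]expr1 -e.
  by rewrite -rmorphM divrr // rmorph1 eqxx.
have [c ec] : [set x | exists b, x = b * a] a'.
  rewrite -aE /= => m; have [b bO e] := api m.+1; exists b => //.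
  have Jpi0 : J pi != 0 by rewrite -(rmorph0 J) (inj_eq J_inj).
  apply: (mulrI (hF Jpi0)); rewrite mulrA -!rmorphM -exprS -e ea.
  by rewrite mulrC.
have /eqP := ea; rewrite ec -subr_eq0 -[X in X - _]mul1r mulrAC -mulrBl.
rewrite mulf_eq0 (negPf a0) orbF => /eqP e.
have := unit_add1 (- c); rewrite mulrN mulrC e.
by rewrite unitr0.
Qed.

(** The partial sums are Cauchy, and every term from index [m] on is divisible by [pi ^+ m.+1]; the
    statement gives away one power. *)
Lemma complete_series (c : nat -> R) : exists l, forall m, exists b,
  l - \sum_(j < m) pi ^+ j.+1 * c j = pi ^+ m * b.
Proof.
pose u m := \sum_(j < m) pi ^+ j.+1 * c j.
have uD k j : exists b, u (k + j)%N - u k = b * pi ^+ k.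
  elim: j => [|j [b eb]]; first by exists 0; rewrite addn0 subrr mul0r.
  exists (b + pi ^+ j.+1 * c (k + j)%N).
  rewrite addnS /u big_ord_recr /= -/(u _) -/(u _) addrAC eb -addnS exprD.
  by ring.
have [k|l lP] := cR piP (u := u).
  exists k => m m' /subnKC <- /subnKC <-.
  have [b eb] := uD k (m - k)%N; have [b' eb'] := uD k (m' - k)%N.
  exists (b - b'); rewrite mulrBl -eb -eb'; by ring.
exists l => m; have [N NP] := lP m.
have [b eb] := uD m N; have [b' eb'] := NP (m + N)%N (leq_addl _ _).
exists (b - b'); rewrite mulrBr mulrC -eb [_ * b']mulrC -eb' -/(u m); by ring.
Qed.

(** Completeness passes from [R] to [O] coordinatewise: each correction [d m] is expanded in the
    generators, and the coordinate series are summed in [R]. *)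
Lemma order_complete (e d : nat -> F) :
    e 0%N \in O -> (forall m, d m \in O) ->
    (forall m, e m.+1 = e m + J (pi ^+ m.+1) * d m) ->
  exists2 l, l \in O & forall m, pi_multiple m (l - e m).
Proof.
move=> e0O dO eS.
have [c cP] := choice (fun m => (SP (d m)).1 (dO m)).
have [l lP] := choice (fun i => complete_series (fun m => c m 0 i)).
exists (e 0%N + (map_mx J (\row_i l i) *m S) 0 0).
  by rewrite rpredD ?map_mx_span.
move=> m.
have eE k : e k = e 0%N +
    (map_mx J (\row_i \sum_(j < k) pi ^+ j.+1 * c j 0 i) *m S) 0 0.
  elim: k => [|k IH].
    rewrite (_ : \row__ _ = 0) ?map_mx0 ?mul0mx ?mxE ?addr0 //.
    by apply/rowP => i; rewrite !mxE big_ord0.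
  rewrite eS IH -addrA; congr (_ + _); rewrite cP !mxE mulr_sumr -big_split /=.
  apply: eq_bigr => i _.
  by rewrite !mxE big_ord_recr /= rmorphD rmorphM mulrDl mulrA.
rewrite [e m]eE opprD addrACA subrr add0r.
have [b bP] := choice (fun i => lP i m).
exists ((map_mx J (\row_i b i) *m S) 0 0); first exact: map_mx_span.
rewrite !mxE mulr_sumr -sumrB; apply: eq_bigr => i _.
by rewrite !mxE -mulrBl -rmorphB bP rmorphM mulrA.
Qed.

(** Each iteration squares the defect [e * e - e] up to a factor from [O]. Only one more power of
    [pi] per step is recorded, which is what [order_complete] asks for; the limit is idempotent
    because its defect is divisible by all powers of [pi]. *)
Lemma lift_idempotent e0 : e0 \in O -> pi_multiple 1 (e0 * e0 - e0) ->
  exists e, [/\ e \in O, e * e = e & pi_multiple 1 (e - e0)].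
Proof.
move=> e0O e0P.
(* Newton's iteration for [X^2 - X] *)
pose N (e : F) := 3 * e ^+ 2 - 2 * e ^+ 3.
(* [F] is not commutative, so identities in the single element [e] are checked in [{poly K}] and
   then evaluated at [e]. *)
have NS e : N e - e = (e * e - e) * (1 - 2 * e).
  have := congr1 (horner_alg e) (_ : 3 * 'X ^+ 2 - 2 * 'X ^+ 3 - 'X
    = ('X * 'X - 'X) * (1 - 2 * 'X) :> {poly K}).
  rewrite !(rmorphB, rmorphM, rmorphXn, rmorph_nat, rmorph1) /= horner_algX.
  by apply; ring.
have NN e : N e * N e - N e = (e * e - e) * (e * e - e) * (4 * (e * e - e) - 3).
  have := congr1 (horner_alg e) (_ : (3 * 'X ^+ 2 - 2 * 'X ^+ 3) *
      (3 * 'X ^+ 2 - 2 * 'X ^+ 3) - (3 * 'X ^+ 2 - 2 * 'X ^+ 3)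
    = ('X * 'X - 'X) * ('X * 'X - 'X) * (4 * ('X * 'X - 'X) - 3) :> {poly K}).
  rewrite !(rmorphB, rmorphM, rmorphXn, rmorph_nat, rmorph1) /= horner_algX.
  by apply; ring.
pose E m := iter m N e0.
have EO m : E m \in O.
  elim: m => //= m IH; rewrite /N.
  by rewrite rpredB // rpredM ?rpredX // rpredMn // rpred1.
have EP m : pi_multiple m.+1 (E m * E m - E m).
  elim: m => //= m IH; rewrite NN; apply: pi_multipleMr; last first.
    have natO k : k%:R \in O by rewrite rpredMn // rpred1.
    by rewrite !(rpredB, rpredM) // ?natO ?EO.
  by apply: pi_multiple_le (pi_multipleM IH IH); rewrite addSn ltnS leq_addl.
have ES m : exists d, d \in O /\ E m.+1 = E m + J (pi ^+ m.+1) * d.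
  have [b bO eb] : pi_multiple m.+1 (E m.+1 - E m).
    rewrite [E m.+1]/= NS; apply: pi_multipleMr (EP m) _.
    by rewrite rpredB ?rpredM ?rpredMn ?rpred1.
  by exists b; split=> //; rewrite -eb addrC subrK.
have [d dP] := choice ES.
have [l lO lP] := order_complete e0O (fun m => (dP m).1) (fun m => (dP m).2).
exists l; split=> //.
  apply/eqP; rewrite -subr_eq0; apply/eqP; apply: pi_multiple_eq0 => m.
  have -> : l * l - l = (l - E m) * l + E m * (l - E m) + (E m * E m - E m)
                        + - (l - E m).
    by rewrite mulrBl mulrBr opprB !subrKA.
  apply: pi_multipleD; last exact/pi_multipleN/lP.
  apply: pi_multipleD; last exact: pi_multiple_le (EP m).
  by apply: pi_multipleD; [apply: pi_multipleMr | apply: pi_multipleMl].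
rewrite -(subrKA (E 1%N)); apply: pi_multipleD; first exact: lP.
have [_ ->] := dP 0%N; rewrite addrC addKr.
by exists (d 0%N) => //; case: (dP 0%N).
Qed.

(* Solve the Cayley-Hamilton equation of [x] for the term of lowest degree [k]
   whose coefficient is a unit. *)
Lemma strongly_pi_regular x : x \in O -> exists k y,
  [/\ y \in O, x * y = y * x & pi_multiple 1 (x ^+ k - x ^+ k.+1 * y)].
Proof.
move=> xO; have [C xC] := mul_order_mx xO.
have cx : commr_rmorph J x by move=> a; rewrite /GRing.comm J_comm.
pose ev : {rmorphism {poly R} -> F} := horner_morph cx.
have evXE : ev 'X = x by exact: horner_morphX.
have evC c : ev c%:P = J c by exact: horner_morphC.
have ev0 : ev 0 = 0 by rewrite rmorph0.
have evX p c : ev (p * 'X + c%:P) = x * ev p + J c.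
  by rewrite rmorphD [p * _]mulrC rmorphM evXE evC.
have evO p : ev p \in O.
  elim/poly_ind: p => [|p c IH]; first by rewrite ev0 rpred0.
  by rewrite evX rpredD ?rpredM ?J_order.
have evS p : ev p *: S = map_mx J (horner_mx C p) *m S.
  elim/poly_ind: p => [|p c IH].
    by rewrite ev0 scale0r [horner_mx C 0]raddf0 map_mx0 mul0mx.
  have -> : horner_mx C (p * 'X + c%:P) = horner_mx C p *m C + c%:M.
    by rewrite !rmorphD !rmorphM /= horner_mx_X horner_mx_C.
  rewrite evX scalerDl -scalerA IH -scale_map_mx xC map_mxD mulmxDl mulmxA map_mxM.
  by rewrite map_scalar_mx mul_scalar_mx.
have ev_comm p : x * ev p = ev p * x.
  by rewrite -[x]evXE -!rmorphM mulrC.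
pose chi := char_poly C.
have ev_chi : ev chi = 0.
  have /SP[c c1] := rpred1 O.
  rewrite -[ev chi]mulr1 c1.
  have /matrixP/(_ 0 0) := scale_map_mx c S (ev chi).
  rewrite [RHS]mxE => <-; rewrite evS Cayley_Hamilton.
  by rewrite map_mx0 mul0mx mulmx0 mxE.
have exu : exists i, chi`_i \is a GRing.unit.
  exists (size chi).-1; rewrite -/(lead_coef chi) (monicP _) ?unitr1 //.
  exact: char_poly_monic.
have [k uk kmin] := ex_minnP exu.
have low : pi_multiple 1 (ev (take_poly k chi)).
  rewrite /take_poly poly_def rmorph_sum.
  apply: (big_ind (pi_multiple 1)) => [|y z|i _].
  - by exists 0; rewrite ?rpred0 ?mulr0.
    exact: pi_multipleD.
  rewrite -mul_polyC rmorphM; apply: pi_multipleMr => //.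
  rewrite evC; have [c ->] : exists c, chi`_i = c * pi.
    by apply/piP; apply/negP => /kmin; rewrite leqNgt ltn_ord.
  by exists (J c); rewrite ?J_order // expr1 mulrC rmorphM.
pose y := - (J (chi`_k)^-1 * ev (drop_poly k.+1 chi)).
exists k, y; split; first by rewrite rpredN rpredM ?J_order.
  by rewrite /y mulrN mulNr mulrA -J_comm -!mulrA ev_comm.
have {ev_chi} : ev (take_poly k chi) + J chi`_k * x ^+ k
    + x ^+ k.+1 * ev (drop_poly k.+1 chi) = 0.
  rewrite -[RHS]ev_chi -[in RHS](poly_take_drop k.+1 chi) rmorphD; congr (_ + _).
    rewrite /take_poly !poly_def big_ord_recr rmorphD; congr (_ + _).
    by rewrite -mul_polyC rmorphM rmorphXn evXE evC.
  by rewrite mulrC rmorphM rmorphXn evXE.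
move/(congr1 ( *%R (J (chi`_k)^-1))); rewrite mulr0 !mulrDr mulrA -rmorphM mulVr //.
rewrite rmorph1 mul1r mulrA J_comm -mulrA addrAC -addrA => /eqP.
rewrite addr_eq0 => /eqP e; rewrite /y mulrN opprK addrC.
rewrite mulrA -[x ^+ k.+1 * _]J_comm -mulrA -[X in pi_multiple 1 X]opprK -e.
by apply/pi_multipleN/pi_multipleMr => //; apply: J_order.
Qed.

(* With [y] as in [strongly_pi_regular], [x ^+ k * y ^+ k] is idempotent modulo
   [pi]; it lifts to an idempotent of [O], that is, to 0 or 1. *)
Lemma order_local_span x : x \in O ->
  (exists2 b, b \in O & x * b = 1) \/ (exists2 b, b \in O & (1 - x) * b = 1).
Proof.
move=> xO; have [k0 [y [yO xy kP]]] := strongly_pi_regular xO.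
(* The exponent is made positive so that a factor [x] can be split off from [x ^+ k.+1] at the
   end. *)
have {k0 kP} [k kP] : exists k, pi_multiple 1 (x ^+ k.+1 - x ^+ k.+2 * y).
  exists k0; rewrite [x ^+ k0.+2]exprS -mulrA [X in X - _]exprS -mulrBr.
  by apply: pi_multipleMl => //.
have powP j : pi_multiple 1 (x ^+ k.+1 - x ^+ (k.+1 + j) * y ^+ j).
  elim: j => [|j IH].
    by rewrite addn0 expr0 mulr1 subrr; exists 0; rewrite ?rpred0 ?mulr0.
  rewrite -(subrKA (x ^+ (k.+1 + j) * y ^+ j)); apply: pi_multipleD => //.
  have -> : x ^+ (k.+1 + j) * y ^+ j - x ^+ (k.+1 + j.+1) * y ^+ j.+1
      = x ^+ j * (x ^+ k.+1 - x ^+ k.+2 * y) * y ^+ j.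
    rewrite (_ : k.+1 + j.+1 = j + k.+2)%N; last by rewrite addnC addSnnS.
    rewrite [(k.+1 + j)%N]addnC !exprD [y ^+ j.+1]exprS.
    move: (x ^+ k.+2) (x ^+ k.+1) => a b.
    by rewrite mulrBr mulrBl !mulrA.
  by apply: pi_multipleMr (pi_multipleMl _ _) _; rewrite ?rpredX.
pose e0 := x ^+ k.+1 * y ^+ k.+1.
have e0O : e0 \in O by rewrite rpredM ?rpredX.
have e0P : pi_multiple 1 (e0 * e0 - e0).
  have -> : e0 * e0 - e0 =
      - (x ^+ k.+1 - x ^+ (k.+1 + k.+1) * y ^+ k.+1) * y ^+ k.+1.
    rewrite opprB mulrBl exprD; congr (_ - _); rewrite /e0 -!mulrA; congr (_ * _).
    rewrite !mulrA; congr (_ * _); apply/esym/commrX/commr_sym/commrX/esym.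
    by rewrite /GRing.comm xy.
  by apply: pi_multipleMr (pi_multipleN (powP _)) _; rewrite rpredX.
have [e [eO ee eP]] := lift_idempotent e0O e0P.
have : e = 0 \/ e = 1.
  have [->|/hF ue] := eqVneq e 0; first by left.
  by right; apply: (mulrI ue); rewrite ee mulr1.
(* If [e = 0], then [x ^+ k.+1] is divisible by [pi], so [1 - x ^+ k.+1] is invertible, and [1 - x]
   divides it by the geometric sum. If [e = 1], then [e0] is 1 modulo [pi], hence invertible, and
   [x] is a left factor of it. *)
case=> e_val; [right | left].
  have [b bO xb] : pi_multiple 1 (x ^+ k.+1).
    rewrite -(subrK (x ^+ (k.+1 + k.+1) * y ^+ k.+1) (x ^+ k.+1)).
    apply: pi_multipleD; first exact: powP.
    rewrite exprD -mulrA; apply: pi_multipleMl; last by rewrite rpredX.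
    by rewrite -/e0 -[e0]opprK -[- e0]add0r -e_val; apply: pi_multipleN.
  have [c cO] := one_sub_pi bO; rewrite -[pi]expr1 -xb => bc.
  exists ((\sum_(i < k.+1) x ^+ i) * c).
    by rewrite rpredM ?rpred_sum // => i _; rewrite rpredX.
  by rewrite mulrA -opprB mulNr -subrX1 opprB.
have [b bO e0b] := eP; have [c cO bc] := one_sub_pi bO.
exists (x ^+ k * y ^+ k.+1 * c); first by rewrite !rpredM ?rpredX.
by rewrite !mulrA -exprS -/e0 -bc -[pi in J pi]expr1 -e0b e_val opprB addrC subrK.
Qed.

End Span.

End CompleteOrder.

Section OrderLocal.
Variables (R : idomainType) (K : fieldType) (iota : {rmorphism R -> K}).
Hypotheses (hR : discrete_valuation_ring R) (cR : adically_complete R).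
Hypothesis hK : quotient_field iota.
Variables (F : falgType K) (O : subringClosed F).
Hypotheses (hF : skew_field F) (hO : is_order iota O).

Let J : {rmorphism R -> F} := in_alg F \o iota.
Let JE a x : J a * x = iota a *: x.
Proof. by rewrite /J /= mulr_algl. Qed.

Lemma order_local x : x \in O ->
  (exists2 b, b \in O & x * b = 1) \/ (exists2 b, b \in O & (1 - x) * b = 1).
Proof.
have [pi pi0 piP] := exists_residue_generator hR.
have [n [S SP]] := order_span hO JE.
exact: (order_local_span hR cR hK hF hO JE pi0 piP SP).
Qed.

Lemma order_nonunit :
  exists2 x, x \in O /\ x != 0 & forall b, b \in O -> x * b != 1.
Proof.
have [pi pi0 piP] := exists_residue_generator hR.
have [n [S SP]] := order_span hO JE.
exists (J pi); last by move=> b; exact: (pi_not_invertible hR JE piP SP).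
split; first exact: (J_order SP).
by rewrite -(rmorph0 J) (inj_eq (J_inj hK JE)).
Qed.

End OrderLocal.

(** * Exchange of idempotents with local corner rings *)

Section LocalCorners.
Variable A : pzRingType.
Implicit Types e f x y : A.

(** Membership in the ring [f A f], whose identity is [f]; units and locality below are relative to
    this identity. *)
Definition corner f x := f * x = x /\ x * f = x.

Definition corner_unit f x := exists y, [/\ corner f y, x * y = f & y * x = f].

Definition local_corner f := [/\ f * f = f, f != 0 &
  forall x, corner f x -> corner_unit f x \/ corner_unit f (f - x)].

Lemma corner_mid f x : f * f = f -> corner f (f * x * f).
Proof. by move=> ff; split; rewrite ?mulrA ?ff // -mulrA ff. Qed.

Lemma cornerM f x y : corner f x -> corner f y -> corner f (x * y).
Proof. by move=> [fx _] [_ yf]; split; rewrite ?mulrA ?fx // -mulrA yf. Qed.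

Lemma cornerD f x y : corner f x -> corner f y -> corner f (x + y).
Proof.
by move=> [fx xf] [fy yf]; split; rewrite ?mulrDr ?mulrDl ?fx ?xf ?fy ?yf.
Qed.

Lemma corner_idem f x : local_corner f -> corner f x -> x * x = x -> x = 0 \/ x = f.
Proof.
move=> [ff _ loc] fx xx; have [fxl fxr] := fx.
case: (loc x fx) => -[y [[fy yf] xy yx]].
  by right; rewrite -fxl -yx -mulrA xx.
left; rewrite -fxl -yx -mulrA mulrBl fxl xx subrr mulr0 //.
Qed.

(** One-sided inverses are two-sided here: [x * y] is idempotent, hence 0 or [f], and 0 is excluded
    since [f = y * (x * y) * x]. *)
Lemma corner_unit_left f x y : local_corner f -> corner f x -> corner f y ->
  y * x = f -> corner_unit f x.
Proof.
move=> lf fx fy yx; have [ff f0 _] := lf.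
exists y; split=> //; have [||e|//] := corner_idem (x := x * y) lf.
- exact: cornerM.
- by rewrite mulrA -(mulrA x) yx (proj2 fx).
case/eqP: f0; rewrite -ff -[X in X * _]yx -yx.
by rewrite -mulrA (mulrA x) e mul0r mulr0.
Qed.

(** With [c] inverse to [x + y], the elements [c * x] and [c * y] add up to [f], so locality makes
    one of them a unit. *)
Lemma corner_unitD f x y : local_corner f -> corner f x -> corner f y ->
  corner_unit f (x + y) -> corner_unit f x \/ corner_unit f y.
Proof.
move=> lf fx fy [c [fc xyc cxy]]; have [ff f0 loc] := lf.
have cornerL z : corner f z -> corner_unit f (c * z) -> corner_unit f z.
  move=> fz [d [fd _ dcz]]; apply: (corner_unit_left (y := d * c)) => //.
    exact: cornerM.
  by rewrite -mulrA.
case: (loc (c * x)); first exact: cornerM.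
  by move/(cornerL _ fx); left.
have -> : f - c * x = c * y by rewrite -[X in X - _]cxy mulrDr addrAC subrr add0r.
by move/(cornerL _ fy); right.
Qed.

Lemma corner_unit_sum f (I : Type) (r : seq I) (x : I -> A) : local_corner f ->
  (forall i, corner f (x i)) -> corner_unit f (\sum_(i <- r) x i) ->
  exists i, corner_unit f (x i).
Proof.
move=> lf fx; have [ff f0 _] := lf.
have c0 : corner f 0 by split; rewrite ?mulr0 ?mul0r.
elim: r => [|i r IH].
  rewrite big_nil => -[y [_ e _]]; case/eqP: f0.
  by rewrite -e mul0r.
rewrite big_cons => /(corner_unitD lf (fx i)) []; last by [].
- by apply: big_ind => // *; apply: cornerD.
- by exists i.
Qed.

Lemma square_zero_inverse (m : A) : m * m = 0 -> mutual_inverse (1 - m) (1 + m).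
Proof.
move=> mm; split; first by rewrite mulrBl !mulrDr !mul1r !mulr1 mm addr0 addrK.
by rewrite mulrDl !mulrBr !mul1r !mulr1 mm subr0 subrK.
Qed.

(** The relations [f * e = f] and [e * f = e] say that the two projections have the same kernel.
    Their difference then has square zero, so the conjugating factors are mutually inverse
    shears. *)
Lemma conj_same_kernel e f : e * e = e -> f * f = f -> f * e = f -> e * f = e ->
  (f - e) * (f - e) = 0 /\ (1 - (f - e)) * f * (1 + (f - e)) = e.
Proof.
move=> ee ff fe ef; split; first by rewrite mulrBr !mulrBl ff fe ef ee subrr.
rewrite mulrBl mul1r [(f - e) * f]mulrBl ff ef subKr mulrDr mulr1 mulrBr ef ee.
by rewrite subrr addr0.
Qed.

Lemma conj_same_image e f : e * e = e -> f * f = f -> f * e = e -> e * f = f ->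
  (f - e) * (f - e) = 0 /\ (1 + (f - e)) * f * (1 - (f - e)) = e.
Proof.
move=> ee ff fe ef; split; first by rewrite mulrBr !mulrBl ff fe ef ee !subrr.
rewrite mulrDl mul1r [(f - e) * f]mulrBl ff ef subrr addr0.
rewrite mulrBr mulr1 mulrBr ff fe.
by rewrite subKr.
Qed.

(* Some [f e_i f] is invertible in the corner of [f], with inverse [c], say. Then
   [h = c e_i] is an idempotent with the image of [f] and the kernel of [e_i]. *)
Lemma exchange_idempotent n (e : 'I_n -> A) f :
    (forall i, local_corner (e i)) -> \sum_i e i = 1 -> local_corner f ->
  exists i u v, [/\ mutual_inverse u v, u * f * v = e i &
    forall z, e i * z = 0 -> z * e i = 0 -> f * z = 0 -> z * f = 0 -> u * z * v = z]
  /\ e i * f != 0.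
Proof.
move=> le e1 lf; have [ff f0 _] := lf.
have [|i [c [[fc cf] xc cx]]] := corner_unit_sum (f := f) (r := index_enum 'I_n)
    (x := fun i => f * e i * f) lf (fun i => corner_mid _ ff).
  rewrite -mulr_suml -mulr_sumr e1 mulr1 ff; exists f; split=> //.
have [ii i0 _] := le i; set g := e i in ii i0 xc cx *.
have cgf : c * g * f = f by rewrite -[c in LHS]cf -[c * f * g]mulrA -mulrA.
have cgc : c * g * c = c by rewrite -[X in _ * X]fc mulrA cgf.
(* [g * c * g] is an idempotent of the local corner of [g]; if it were 0, then [c], and with it [f],
   would vanish. *)
have gcg : g * c * g = g.
  have [||e0|//] := corner_idem (x := g * c * g) (le i).
  - exact: corner_mid.
  - rewrite !mulrA -[_ * g * g]mulrA ii; congr (_ * g).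
    by rewrite -!mulrA (mulrA c) cgc.
  case/eqP: f0; rewrite -cgf -cgc.
  suff -> : c * g * c = 0 by rewrite !mul0r.
  rewrite -[c in X in X = _]cgc -!mulrA (mulrA g c) (mulrA (g * c)) e0.
  by rewrite mul0r mulr0.
pose h := c * g.
have hh : h * h = h by rewrite /h mulrA cgc.
have hg : h * g = h by rewrite /h -mulrA ii.
have gh : g * h = g by rewrite /h mulrA.
have fh : f * h = h by rewrite /h mulrA fc.
have hf : h * f = f by [].
have [mm me] := conj_same_kernel ii hh hg gh.
have [mm' me'] := conj_same_image hh ff fh hf.
set m := h - g in mm me; set m' := f - h in mm' me'.
exists i, ((1 - m) * (1 + m')), ((1 - m') * (1 + m)); split; last first.
  by apply: contraNneq f0 => gf; rewrite -cgf -mulrA gf mulr0.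
have [i1 i2] := square_zero_inverse mm; have [i3 i4] := square_zero_inverse mm'.
split.
- split; first by rewrite -mulrA (mulrA (1 + m')) i4 mul1r.
  by rewrite -mulrA (mulrA (1 + m)) i2 mul1r.
- by rewrite -/g -[RHS]me -me' !mulrA.
(* An element annihilated on both sides by [e i] and by [f] is annihilated by [h], hence by [m] and
   [m'], so both shears commute past it. In [krull_schmidt] this keeps the idempotents already
   treated in place. *)
move=> z ez ze fz zf.
have hz : h * z = 0 by rewrite /h -mulrA ez mulr0.
have zh : z * h = 0 by rewrite -fh mulrA zf mul0r.
have mz : m * z = 0 by rewrite mulrBl hz ez subrr.
have mz' : m' * z = 0 by rewrite mulrBl hz fz subrr.
have zm : z * m = 0 by rewrite mulrBr zh ze subrr.
have zm' : z * m' = 0 by rewrite mulrBr zh zf subrr.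
have -> : (1 - m) * (1 + m') * z = z.
  by rewrite -mulrA [(1 + m') * z]mulrDl mul1r mz' addr0 mulrBl mul1r mz subr0.
by rewrite mulrA [z * (1 - m')]mulrBr mulr1 zm' subr0 mulrDr mulr1 zm addr0.
Qed.

(** The idempotents [f j] are moved one at a time. The next one, conjugated to [g], is orthogonal to
    the [e (pi j)] already reached; since the exchange gives [e i * g != 0], the new index [i]
    differs from all [pi j], and the exchange fixes each [e (pi j)]. *)
Lemma krull_schmidt n (e f : 'I_n -> A) :
    (forall i, local_corner (e i)) -> \sum_i e i = 1 ->
    (forall i j, i != j -> e i * e j = 0) ->
    (forall i, local_corner (f i)) -> (forall i j, i != j -> f i * f j = 0) ->
  exists u v (pi : 'I_n -> 'I_n),
    mutual_inverse u v /\ forall i, u * f i * v = e (pi i).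
Proof.
move=> le e1 ee lf ff.
suff H (k : nat) : exists u v (pi : 'I_n -> 'I_n), mutual_inverse u v /\
    forall i : 'I_n, (i < k)%N -> u * f i * v = e (pi i).
  by have [u [v [pi [uv H']]]] := H n; exists u, v, pi; split=> // i; apply: H'.
elim: k => [|k [u [v [pi [[uv vu] H]]]]]; first exists 1, 1, id.
  by split=> //; split; rewrite mulr1.
have [lt_kn|le_nk] := ltnP k n; last first.
  exists u, v, pi; split=> // i _; apply: H; exact: leq_trans (ltn_ord i) le_nk.
pose i0 := Ordinal lt_kn; pose g := u * f i0 * v.
have conjM x y : u * x * v * (u * y * v) = u * (x * y) * v.
  by rewrite !mulrA -(mulrA _ v u) vu mulr1.
have conjM' x y : v * x * u * (v * y * u) = v * (x * y) * u.
  by rewrite !mulrA -(mulrA _ u v) uv mulr1.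
have conjK x : v * (u * x * v) * u = x by rewrite !mulrA vu mul1r -mulrA vu mulr1.
have conjK' x : u * (v * x * u) * v = x by rewrite !mulrA uv mul1r -mulrA uv mulr1.
have lg : local_corner g.
  have [fi f0 loc] := lf i0; split.
  - by rewrite conjM fi.
  - by apply: contraNneq f0 => g0; rewrite -(conjK (f i0)) -/g g0 mulr0 mul0r.
  move=> x [gx xg]; have cx : corner (f i0) (v * x * u).
    by split; rewrite -[f i0]conjK -/g conjM' ?gx ?xg.
  have tr y : corner_unit (f i0) y -> corner_unit g (u * y * v).
    move=> [z [[fz zf] yz zy]]; exists (u * z * v); split.
    - by split; rewrite conjM ?fz ?zf.
    - by rewrite conjM yz.
    - by rewrite conjM zy.
  case: (loc _ cx) => /tr; first by rewrite conjK'; left.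
  by rewrite mulrBr mulrBl conjK'; right.
have [i [u' [v' [[[uv' vu'] Hg Hz] ig0]]]] := exchange_idempotent le e1 lg.
exists (u' * u), (v * v'), (fun j => if j == i0 then i else pi j); split.
  split; first by rewrite mulrA -(mulrA u') uv mulr1.
  by rewrite mulrA -(mulrA v) vu' mulr1.
move=> j; rewrite ltnS leq_eqVlt => /orP[/eqP jk|lt_jk].
  by rewrite (_ : j = i0) ?eqxx -?Hg ?/g ?mulrA //; apply: val_inj.
have ji0 : j != i0 by apply: contraTneq lt_jk => ->; rewrite ltnn.
rewrite (negPf ji0).
have eg : e (pi j) * g = 0 by rewrite -H // conjM ff // mulr0 mul0r.
have ge : g * e (pi j) = 0 by rewrite -H // conjM ff 1?eq_sym // mulr0 mul0r.
have i_pi : i != pi j by apply: contraNneq ig0 => ->; rewrite eg.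
by rewrite -[RHS]Hz ?ee // 1?eq_sym // -H // !mulrA.
Qed.

End LocalCorners.

(** The interface between the arithmetic of [O] and the study of [H]. Locality is phrased with right
    inverses, which are two-sided in a skew field; the nonzero nonunit forces the radical, hence
    [w], to be nonzero. *)
Definition valuation_order (F : unitRingType) (O : subringClosed F)
    (w : subring_of O) :=
  [/\ skew_field F,
      forall x, x \in O -> (exists2 b, b \in O & x * b = 1) \/
                           (exists2 b, b \in O & (1 - x) * b = 1),
      exists2 x, x \in O /\ x != 0 & forall b, b \in O -> x * b != 1
    & uniformizer w].

(** * Local orders with a uniformizing element *)

Definition ounit (F : unitRingType) (O : subringClosed F) (x : F) :=
  [&& x != 0, x \in O & x^-1 \in O].

Section LocalOrder.
Variables (F : unitRingType) (O : subringClosed F) (w : subring_of O).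
Local Notation ounit := (ounit O).
Hypothesis V : valuation_order w.

Let hF : skew_field F. Proof. by case: V. Qed.
Let hloc := let: And4 _ h _ _ := V in h.
Let hnu := let: And4 _ _ h _ := V in h.
Let hw : uniformizer w. Proof. by case: V. Qed.


Lemma ounit_unit x : ounit x -> x \is a GRing.unit.
Proof. by case/and3P=> /hF. Qed.

Lemma ounit_order x : ounit x -> x \in O.
Proof. by case/and3P. Qed.

Lemma mulr1_ounit x b : x \in O -> b \in O -> x * b = 1 -> ounit x.
Proof.
move=> xO bO xb.
have x0 : x != 0.
  by apply: contra_eqN xb => /eqP ->; rewrite mul0r eq_sym oner_eq0.
by rewrite /ounit x0 xO -[x^-1]mulr1 -xb mulKr ?hF.
Qed.

Lemma mul1r_ounit x b : x \in O -> b \in O -> b * x = 1 -> ounit x.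
Proof.
move=> xO bO bx.
have x0 : x != 0.
  by apply: contra_eqN bx => /eqP ->; rewrite mulr0 eq_sym oner_eq0.
by rewrite /ounit x0 xO -[x^-1]mul1r -bx mulrK ?hF.
Qed.

Lemma ounit1 : ounit 1.
Proof. by rewrite /ounit oner_eq0 invr1 rpred1. Qed.

Lemma ounitM x y : ounit x -> ounit y -> ounit (x * y).
Proof.
move=> ux uy; apply: (mulr1_ounit (b := y^-1 * x^-1)).
- by rewrite rpredM ?ounit_order.
- by case/and3P: ux; case/and3P: uy => *; rewrite rpredM.
by rewrite mulrA mulrK ?divrr ?ounit_unit.
Qed.

(** Locality makes the nonunits a left ideal: if a sum [s] of two elements is a unit, then [s^-1]
    times one of them is a unit. Every proper left ideal consists of nonunits, so this is the only
    maximal one. *)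
Lemma radF_nonunit x : (x \in radF O) = (x \in O) && ~~ ounit x.
Proof.
pose N : set (subring_of O) := [set y | ~~ ounit (val y)].
have lN : left_ideal N.
  split.
  - by rewrite /N /mkset /ounit (rmorph0 val) eqxx.
  - move=> x1 x2 nx1 nx2; apply/negP => us; set s := val (x1 + x2) in us.
    have sO : s^-1 \in O by case/and3P: us.
    have x1O : s^-1 * val x1 \in O by rewrite rpredM // (valP x1).
    have [[b bO e]|[b bO e]] := hloc x1O.
      case/negP: nx1; rewrite -[val x1](mulVKr (ounit_unit us)).
      apply: ounitM => //.
      by apply: (mulr1_ounit (b := b)); rewrite // rpredM // (valP x1).
    case/negP: nx2; rewrite -[val x2](mulVKr (ounit_unit us)); apply: ounitM => //.
    have E : 1 - s^-1 * val x1 = s^-1 * val x2.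
      by rewrite -(mulVr (ounit_unit us)) -mulrBr /s rmorphD addrAC subrr add0r.
    by apply: (mulr1_ounit (b := b)); rewrite -?E // E rpredM // (valP x2).
  - move=> a y ny; apply/negP; rewrite rmorphM => u.
    case/negP: ny; apply: (mul1r_ounit (b := (val a * val y)^-1 * val a)).
    + exact: (valP y).
    + by rewrite rpredM ?(valP a) // ; case/and3P: u.
    by rewrite -mulrA mulVr ?ounit_unit.
have proper (J : set (subring_of O)) : left_ideal J -> ~ J 1 -> J `<=` N.
  move=> [J0 JD JM] J1 y Jy; apply/negP => uy; case/and3P: (uy) => _ _ yV.
  apply: J1; rewrite -(_ : SubringOf yV * y = 1); first exact: JM.
  by apply: val_inj; rewrite rmorphM rmorph1 /= mulVr ?ounit_unit.
have N1 : ~ N 1 by rewrite /N /mkset rmorph1 ounit1.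
apply/asboolP/andP => [[y /radP yr <-]|[xO nu]].
  split; first exact: (valP y).
  by apply: (yr N); split=> // J lJ _ J1; apply: proper.
exists (SubringOf xO) => //; apply/radP => J [lJ J1 Jmax].
by apply: (Jmax N) => //; apply: proper.
Qed.

Lemma radF_order x : x \in radF O -> x \in O.
Proof. by rewrite radF_nonunit => /andP[]. Qed.

Lemma uniformizer_neq0 : val w != 0.
Proof.
have [x [xO x0] xnu] := hnu.
have : x \in radF O.
  rewrite radF_nonunit xO; apply/negP => u; case/and3P: (u) => _ _ /xnu.
  by rewrite divrr ?ounit_unit ?eqxx.
move/asboolP => [y yr yx]; have [a ya] := (hw y).1.1 yr.
by apply: contraNneq x0 => w0; rewrite -yx ya rmorphM [X in X * _]w0 mul0r.
Qed.
Let w0 := uniformizer_neq0.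
Let wu := hF w0.

Lemma radFPl x : reflect (exists2 a, a \in O & x = val w * a) (x \in radF O).
Proof.
apply: (iffP (asboolP _)) => [[y yr <-]|[a aO ->]].
  have [a ->] := (hw y).1.1 yr; exists (val a); first exact: (valP a).
  by rewrite rmorphM.
exists (w * SubringOf aO); last by rewrite rmorphM.
by apply/(hw _).1; exists (SubringOf aO).
Qed.

Lemma radFPr x : reflect (exists2 a, a \in O & x = a * val w) (x \in radF O).
Proof.
apply: (iffP (asboolP _)) => [[y yr <-]|[a aO ->]].
  have [a ->] := (hw y).2.1 yr; exists (val a); first exact: (valP a).
  by rewrite rmorphM.
exists (SubringOf aO * w); last by rewrite rmorphM.
by apply/(hw _).2; exists (SubringOf aO).
Qed.

Lemma radF_w : val w \in radF O.
Proof. by apply/radFPl; exists 1; rewrite ?rpred1 ?mulr1. Qed.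

Lemma conj_w x : x \in O -> val w * x / val w \in O.
Proof.
move=> xO; have /radFPr[a aO ->] : val w * x \in radF O by apply/radFPl; exists x.
by rewrite mulrK.
Qed.

Lemma conj_wV x : x \in O -> (val w)^-1 * x * val w \in O.
Proof.
move=> xO; have : x * val w \in radF O by apply/radFPr; exists x.
by case/radFPl => a aO e; rewrite -mulrA e mulKr.
Qed.

Lemma ounit_sub1 x : x \in radF O -> ounit (1 - x).
Proof.
move=> xr; apply/negP => /negP nu; have : (1 : F) \in radF O.
  rewrite -[1](subrK x) radFD // radF_nonunit nu andbT.
  by rewrite rpredB ?rpred1 // radF_order.
by rewrite radF_nonunit ounit1 andbF.
Qed.

End LocalOrder.

(** * The standard hereditary order and its radical *)

Section HereditaryOrder.
Variables (F : unitRingType) (O : subringClosed F) (w : subring_of O).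
Hypothesis V : valuation_order w.
Variables (r : nat) (p : 'I_r -> nat).
Local Notation N := (\sum_i p i)%N.
Local Notation H := (Hord O p).
Local Notation blk := (@sig1 r p).
Local Notation W := (val w).
Implicit Types (s t u : 'I_N).

(** The condition that [hereditary] imposes at one position; [HentP] rewrites it as membership in
    [W ^+ b * O], with the truth value b of [blk s < blk t] as exponent. *)
Definition Hent s t (x : F) :=
  if (blk t <= blk s)%N then x \in O else x \in radF O.

Lemma Hent_order s t x : Hent s t x -> x \in O.
Proof. by rewrite /Hent; case: ifP => // _ /radF_sub. Qed.

Lemma Hent_rad s t x : x \in radF O -> Hent s t x.
Proof. by rewrite /Hent; case: ifP => // _ /radF_sub. Qed.

Lemma HentP s t x :
  reflect (exists2 a, a \in O & x = W ^+ (blk s < blk t)%N * a) (Hent s t x).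
Proof.
rewrite /Hent; case: leqP => _.
  apply: (iffP idP) => [xO|[a aO ->]]; last by rewrite mul1r.
  by exists x; rewrite ?mul1r.
exact: (radFPl V).
Qed.

Lemma Hent_val (M : H) s t : Hent s t (val M s t).
Proof. by have /hereditaryP := valP M; apply. Qed.

Lemma HentM s t u x y : Hent s t x -> Hent t u y -> Hent s u (x * y).
Proof.
move=> hx hy; have xO := Hent_order hx; have yO := Hent_order hy.
move: hx hy; rewrite /Hent.
have [ts|st] := leqP (blk t) (blk s); have [ut|tu] := leqP (blk u) (blk t) => hx hy.
- by rewrite (leq_trans ut ts) rpredM.
- by case: ifP => _; [rewrite rpredM | apply: radFMl].
- by case: ifP => _; [rewrite rpredM | apply: radFMr].
by case: ifP => _; [rewrite rpredM | apply: radFMl].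
Qed.

Lemma HentD s t x y : Hent s t x -> Hent s t y -> Hent s t (x + y).
Proof. by rewrite /Hent; case: ifP => _; [apply: rpredD | apply: radFD]. Qed.

Lemma HentN s t x : Hent s t x -> Hent s t (- x).
Proof.
rewrite /Hent; case: ifP => _; first by rewrite rpredN.
by rewrite -[- x]sub0r; apply: radFB; apply: radF0.
Qed.

Lemma Hent_diag s x : x \in O -> Hent s s x.
Proof. by rewrite /Hent leqnn. Qed.

Definition entry_mx s t (x : F) : 'M[F]_N :=
  \matrix_(i, j) if (i == s) && (j == t) then x else 0.

Fact mkH_subproof (M : 'M[F]_N) :
  {X : H | (forall s t, Hent s t (M s t)) -> val X = M}.
Proof.
exists (insubd (0 : H) M) => h; rewrite insubdK //.
by apply/hereditaryP => s t; apply: h.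
Qed.

(* Unspecified when [M] is not in the order. *)
Definition mkH M : H := sval (mkH_subproof M).

Lemma mkHK (M : 'M[F]_N) : (forall s t, Hent s t (M s t)) -> val (mkH M) = M.
Proof. exact: (svalP (mkH_subproof M)). Qed.

Definition hdelta s t x : H := mkH (entry_mx s t x).

Lemma val_hdelta s t x : Hent s t x -> val (hdelta s t x) = entry_mx s t x.
Proof.
move=> hx; apply: mkHK => i j; rewrite mxE; case: ifP => [/andP[/eqP-> /eqP->]//|_].
by apply: Hent_rad; apply: radF0.
Qed.

Lemma H_eqP (M M' : H) : (forall s t, val M s t = val M' s t) -> M = M'.
Proof. by move=> h; apply: val_inj; apply/matrixP. Qed.

Lemma entry_mxM s t t' u x y :
  entry_mx s t x *m entry_mx t' u y = if t == t' then entry_mx s u (x * y) else 0.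
Proof.
apply/matrixP => i j; rewrite mxE (bigD1 t) //=.
rewrite [X in _ + X]big1 ?addr0 => [|k kt]; last first.
  by rewrite !mxE (negPf kt) andbF mul0r.
rewrite !mxE eqxx andbT.
case: (eqVneq t t') => [_|ne] /=; last by rewrite mulr0 mxE.
by rewrite mxE; case: eqP; case: eqP; rewrite /= ?mulr0 ?mul0r.
Qed.

Lemma val_mulH (M M' : H) : val (M * M') = val M *m val M'.
Proof. exact: rmorphM. Qed.

Lemma val_subH (M M' : H) : val (M - M') = val M - val M'.
Proof. exact: rmorphB. Qed.

Lemma val_oneH : val (1 : H) = 1%:M.
Proof. exact: rmorph1. Qed.

Lemma val_entryM (M M' : H) s t : val (M * M') s t = \sum_k val M s k * val M' k t.
Proof. by rewrite rmorphM mxE. Qed.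

Lemma val_entryD (M M' : H) s t : val (M + M') s t = val M s t + val M' s t.
Proof. by rewrite rmorphD mxE. Qed.

Lemma val_entryB (M M' : H) s t : val (M - M') s t = val M s t - val M' s t.
Proof. by rewrite rmorphB !mxE. Qed.

Lemma val_entry1 s t : val (1 : H) s t = (s == t)%:R.
Proof. by rewrite rmorph1 mxE. Qed.

Lemma val_entry_sum (I : Type) (l : seq I) (P : pred I) (M : I -> H) s t :
  val (\sum_(i <- l | P i) M i) s t = \sum_(i <- l | P i) val (M i) s t.
Proof. by rewrite rmorph_sum summxE. Qed.

Lemma val_entry_hdelta s t x i j : Hent s t x ->
  val (hdelta s t x) i j = if (i == s) && (j == t) then x else 0.
Proof. by move=> h; rewrite val_hdelta // mxE. Qed.

Lemma hdeltaM s t u x y : Hent s t x -> Hent t u y ->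
  hdelta s t x * hdelta t u y = hdelta s u (x * y).
Proof.
move=> hx hy; apply: val_inj.
rewrite val_mulH (val_hdelta hx) (val_hdelta hy) (val_hdelta (HentM hx hy)).
by rewrite entry_mxM eqxx.
Qed.

Lemma hdeltaM0 s t t' u x y : Hent s t x -> Hent t' u y -> t != t' ->
  hdelta s t x * hdelta t' u y = 0.
Proof.
move=> hx hy ne; apply: val_inj.
by rewrite val_mulH (val_hdelta hx) (val_hdelta hy) entry_mxM (negPf ne) rmorph0.
Qed.

Lemma hdeltaD s t x y : Hent s t x -> Hent s t y ->
  hdelta s t (x + y) = hdelta s t x + hdelta s t y.
Proof.
move=> hx hy; apply: H_eqP => i j.
rewrite val_entryD !val_entry_hdelta //; last exact: HentD.
by case: ifP => _; rewrite ?addr0.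
Qed.

Lemma hdelta0 s t : hdelta s t 0 = 0.
Proof.
apply: H_eqP => i j; rewrite val_entry_hdelta ?if_same ?rmorph0 ?mxE //.
by apply: Hent_rad; apply: radF0.
Qed.

Definition hidem s : H := hdelta s s 1.

Lemma Hent1 s : Hent s s 1. Proof. by apply: Hent_diag; rewrite rpred1. Qed.
Hint Resolve Hent1 Hent_val : core.

Lemma val_entry_hidem s i j : val (hidem s) i j = ((i == s) && (j == s))%:R.
Proof. by rewrite /hidem val_entry_hdelta //; case: (_ && _). Qed.

Lemma hidem_sum : \sum_s hidem s = 1.
Proof.
apply: H_eqP => i j; rewrite val_entry_sum val_entry1 (bigD1 i) //=.
rewrite [X in _ + X]big1 ?addr0 => [|k ki]; rewrite val_entry_hidem.
  by rewrite eqxx eq_sym.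
by rewrite [i == k]eq_sym (negPf ki).
Qed.

Lemma hidem_orth s t : s != t -> hidem s * hidem t = 0.
Proof. by move=> ne; apply: hdeltaM0. Qed.

Lemma hidem_idem s : hidem s * hidem s = hidem s.
Proof. by rewrite /hidem hdeltaM // mulr1. Qed.

Lemma hidemM s (M : H) i j :
  val (hidem s * M) i j = if i == s then val M s j else 0.
Proof.
rewrite val_entryM (bigD1 s) //= [X in _ + X]big1 ?addr0 => [|k ks].
  by rewrite val_entry_hidem eqxx andbT; case: eqP; rewrite ?mul1r ?mul0r.
by rewrite val_entry_hidem (negPf ks) andbF mul0r.
Qed.

Lemma Mhidem s (M : H) i j :
  val (M * hidem s) i j = if j == s then val M i s else 0.
Proof.
rewrite val_entryM (bigD1 s) //= [X in _ + X]big1 ?addr0 => [|k ks].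
  by rewrite val_entry_hidem eqxx /=; case: eqP; rewrite ?mulr1 ?mulr0.
by rewrite val_entry_hidem (negPf ks) mulr0.
Qed.

Lemma hidemMhidem s t (M : H) : hidem s * M * hidem t = hdelta s t (val M s t).
Proof.
apply: H_eqP => i j; rewrite Mhidem hidemM val_entry_hdelta //.
by case: (i == s); case: (j == t).
Qed.

Lemma sum_hdelta (M : H) : M = \sum_s \sum_t hdelta s t (val M s t).
Proof.
rewrite -[LHS]mulr1 -[LHS]mul1r -!hidem_sum mulr_suml; apply: eq_bigr => s _.
rewrite mulr_sumr mulr_sumr; apply: eq_bigr => t _.
by rewrite -hidemMhidem mulrA.
Qed.

Lemma hidem_neq0 s : hidem s != 0.
Proof.
apply/eqP => /(congr1 (fun M : H => val M s s)).
by rewrite val_entry_hidem !eqxx rmorph0 mxE => /eqP; rewrite oner_eq0.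
Qed.

Lemma cornerE s (M : H) : corner (hidem s) M -> M = hdelta s s (val M s s).
Proof. by move=> [hidemM Mhidem]; rewrite -hidemMhidem hidemM Mhidem. Qed.

(** The corner ring at [s] is a copy of [O], through the entry at (s, s). *)
Lemma hidem_local s : local_corner (hidem s).
Proof.
split; [exact: hidem_idem | exact: hidem_neq0 |] => M cM.
have MO : val M s s \in O by apply: (Hent_order (Hent_val M s s)).
have cE x : x \in O -> corner (hidem s) (hdelta s s x).
  by move=> xO; split; rewrite hdeltaM ?mul1r ?mulr1 //; apply: Hent_diag.
have unitE x : ounit O x -> corner_unit (hidem s) (hdelta s s x).
  move=> ux; have /and3P[_ xO xVO] := ux; exists (hdelta s s x^-1).
  by split; rewrite ?hdeltaM ?divrr ?mulVr ?(ounit_unit V) //;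
    do ?[exact: cE | exact: Hent_diag].
have [_ loc _ _] := V; have [[b bO xb]|[b bO xb]] := loc _ MO; [left | right].
  by rewrite (cornerE cM); apply: unitE; apply: (mulr1_ounit V) xb.
have -> : hidem s - M = hdelta s s (1 - val M s s).
  rewrite [in LHS](cornerE cM) hdeltaD ?HentN //.
  congr (_ + _); apply: (addrI (hdelta s s (val M s s))).
  rewrite subrr -hdeltaD ?HentN //.
  by rewrite subrr hdelta0.
by apply: unitE; apply: (mulr1_ounit V _ bO xb); rewrite rpredB // rpred1.
Qed.

End HereditaryOrder.

(** * Quasi-regular elements and the Jacobson radical *)

Section QuasiRegular.
Variable A : pzRingType.

Definition quasi_regular (x : A) := forall a, exists b, b * (1 - a * x) = 1.

(** If [b] is a left inverse of [1 - a * x], then [b * (1 - a * (x + y)) = 1 - b * a * y], and [y]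
    supplies the second left inverse. *)
Lemma quasi_regularD x y :
  quasi_regular x -> quasi_regular y -> quasi_regular (x + y).
Proof.
move=> qx qy a; have [b bx] := qx a; have [c cy] := qy (b * a).
by exists (c * b); rewrite [a * _]mulrDr opprD addrA -mulrA [b * _]mulrBr bx mulrA.
Qed.

(** A maximal left ideal [J] missing [x] would satisfy [J + A x = A], so it would contain some
    [1 - a * x], which is left invertible. *)
Lemma quasi_regular_rad x : quasi_regular x -> x \in Defs.rad A.
Proof.
move=> qx; apply/radP => J [[J0 JD JM] J1 Jmax]; apply: contrapT => nJx.
pose J' : set A := [set y | exists a j, J j /\ y = j + a * x].
have J'1 : J' 1.
  apply: contrapT => nJ'1; apply: nJx; apply: (Jmax J') => //.
  - split.
    + by exists 0, 0; rewrite mul0r addr0.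
    + move=> _ _ [a [j [Jj ->]]] [a' [j' [Jj' ->]]]; exists (a + a'), (j + j').
      by split; [exact: JD | rewrite mulrDl addrACA].
    + move=> b _ [a [j [Jj ->]]]; exists (b * a), (b * j).
      by split; [exact: JM | rewrite mulrDr mulrA].
  - by move=> j Jj; exists 0, j; rewrite mul0r addr0.
  - by exists 1, 0; rewrite mul1r add0r.
have [a [j [Jj e]]] := J'1; have [b be] := qx a; apply: J1.
by rewrite -be e addrK; apply: JM.
Qed.

(** The left inverse [b] of [1 - x] equals [1 + b * x], so by quasi-regularity it has a left inverse
    too. *)
Lemma quasi_regular_sub1_unit x : quasi_regular x -> invertible (1 - x).
Proof.
move=> qx; have [b] := qx 1; rewrite mul1r => bx.
have [c] := qx (- b).
have -> : 1 - - b * x = b by rewrite mulNr opprK -bx mulrBr mulr1 subrK.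
move=> cb; exists b; split=> //.
have <- // : c = 1 - x.
rewrite -[c]mulr1 -[X in _ * X]bx mulrA. by rewrite cb mul1r.
Qed.

End QuasiRegular.

Lemma sum_blocks (U : nmodType) (r : nat) (p : 'I_r -> nat)
    (f : 'I_(\sum_i p i) -> U) :
  \sum_k f k = \sum_i \sum_j f (Rank i j).
Proof.
rewrite sig_big_dep /= (reindex _ sig_bij_on) /=.
by apply: eq_bigr => k _; rewrite sig2K.
Qed.

(** * The radical of [H] and the isomorphism [theta] *)

Section HereditaryRadical.
Variables (F : unitRingType) (O : subringClosed F) (w : subring_of O).
Hypothesis V : valuation_order w.
Variables (r : nat) (p : 'I_r -> nat).
Local Notation N := (\sum_i p i)%N.
Local Notation H := (Hord O p).
Local Notation blk := (@sig1 r p).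
Implicit Types (s t u : 'I_N).

Definition diag_rad (M : H) := forall s t, blk s = blk t -> val M s t \in radF O.

(* [1 - z] is inverted explicitly, as [z = a * hdelta O s t c] is concentrated in
   column [t]. *)
Lemma hdelta_quasi_regular s t c :
  Hent O s t c -> (blk s = blk t -> c \in radF O) ->
  quasi_regular (hdelta O s t c).
Proof.
move=> hc cr a; pose z := a * hdelta O s t c; pose x := val z t t.
have ez : z * hidem O t = z.
  by rewrite /z -mulrA /hidem hdeltaM ?mulr1 //; apply: Hent1.
have xr : x \in radF O.
  have xE : x = val a t s * c.
    rewrite /x /z val_entryM (bigD1 s) //= [X in _ + X]big1 ?addr0 => [|k ks].
      by rewrite val_entry_hdelta // !eqxx.
    by rewrite val_entry_hdelta // (negPf ks) mulr0.
  have := Hent_val a t s; rewrite xE /Hent.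
  have aO := Hent_order (Hent_val a t s); have cO := Hent_order hc.
  case: leqP => [le_st _|_ ar]; last exact: radFMr.
  apply: radFMl => //; move: hc; rewrite /Hent; case: leqP => // le_ts _.
  by apply: cr; apply: val_inj; apply/eqP; rewrite eqn_leq le_st.
have ux := ounit_sub1 V xr; have yO : (1 - x)^-1 \in O by case/and3P: ux.
pose y := (1 - x)^-1; pose z' := z * hdelta O t t y.
exists (1 + z').
have hx : Hent O t t x by exact: Hent_val.
have z'z : z' * z = z * hdelta O t t (y * x).
  rewrite /z' -[in X in _ * X]ez -mulrA; congr (_ * _).
  have hy : Hent O t t y by apply: Hent_diag.
  rewrite -[y in LHS]mulr1 -(hdeltaM hy (Hent1 _ _)) -mulrA (mulrA _ z).
  by rewrite hidemMhidem hdeltaM.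
have z'B : z' - z' * z = z.
  rewrite z'z /z' -mulrBr -[RHS]ez; congr (_ * _).
  apply: (addIr (hdelta O t t (y * x))).
  have hy : Hent O t t y by apply: Hent_diag.
  rewrite subrK /hidem -hdeltaD ?Hent1 //; last exact: HentM hy hx.
  congr (hdelta _ _ _); apply: (addIr (- (y * x))).
  rewrite addrK -[X in X - _]mulr1.
  by rewrite -mulrBr mulVr // (ounit_unit V).
by rewrite mulrDl mul1r mulrBr mulr1 z'B subrK.
Qed.

Lemma diag_rad_quasi_regular M : diag_rad M -> quasi_regular M.
Proof.
move=> dM; rewrite (sum_hdelta M).
have q0 : quasi_regular (0 : H) by move=> a; exists 1; rewrite mulr0 subr0 mulr1.
do 2![apply: big_ind => [||? _]; [exact: q0 | exact: quasi_regularD |]].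
by apply: hdelta_quasi_regular; [apply: Hent_val | apply: dM].
Qed.

(* [col_ideal t] is the preimage of the maximal left ideal of matrices with
   vanishing column [t] in the corresponding factor of the semisimple quotient. *)
Definition col_ideal t : set H :=
  [set M : H | forall s, blk s = blk t -> val M s t \in radF O].

Lemma col_ideal_maximal t : maximal_left_ideal (col_ideal t).
Proof.
have lM (a M : H) s : col_ideal t M -> blk s = blk t -> val (a * M) s t \in radF O.
  move=> cM st; rewrite val_entryM.
  apply: (big_ind (fun z => z \in radF O)) => [||k _].
  - exact: radF0.
  - exact: radFD.
  have aO := Hent_order (Hent_val a s k); have MO := Hent_order (Hent_val M k t).
  have [kt|kt] := eqVneq (blk k) (blk t); first exact: radFMl (cM _ kt).
  have := Hent_val a s k; have := Hent_val M k t; rewrite /Hent st.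
  case: leqP => [le_tk _|_ Mr _]; last exact: radFMl.
  case: leqP => [le_kt|_ ar]; last exact: radFMr.
  by case/eqP: kt; apply: val_inj; apply/eqP; rewrite eqn_leq le_tk le_kt.
split.
- split.
  + by move=> s _; rewrite rmorph0 mxE radF0.
  + by move=> M M' cM cM' s st; rewrite val_entryD radFD ?cM ?cM'.
  + by move=> a M cM s st; apply: lM.
- move=> /(_ t erefl); rewrite val_entry1 eqxx (radF_nonunit V).
  by rewrite (ounit1 O) andbF.
move=> J [J0 JD JM] sub J1 M JMm s st; apply: contrapT => /negP.
rewrite (radF_nonunit V) (Hent_order (Hent_val M s t)) negbK => uM.
have /and3P[_ _ uV] := uM; apply: J1.
have hts : Hent O t s (val M s t)^-1 by rewrite /Hent st leqnn.
(* [Y] has only row [t], with 1 on the diagonal, so column [t] vanishes in both [hidem t - Y] and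
   [1 - hidem t]. These lie in the column ideal, [Y] lies in [J], and together they add up to 1. *)
pose Y := hdelta O t s (val M s t)^-1 * M.
have YE i j : val Y i j = if i == t then (val M s t)^-1 * val M s j else 0.
  rewrite val_entryM (bigD1 s) //= [X in _ + X]big1 ?addr0 => [|k ks].
    by rewrite val_entry_hdelta // eqxx andbT; case: eqP; rewrite ?mul0r.
  by rewrite val_entry_hdelta // (negPf ks) andbF mul0r.
have -> : 1 = Y + (hidem O t - Y) + (1 - hidem O t).
  by rewrite [Y + _]addrC subrK addrC subrK.
apply: (JD); first apply: (JD); first exact: JM.
  apply: sub => i it; rewrite val_entryB YE val_entry_hidem eqxx andbT.
  case: eqP => _; last by rewrite subrr radF0.
  by rewrite mulVr ?subrr ?radF0 // (ounit_unit V).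
apply: sub => i it; rewrite val_entryB val_entry1 val_entry_hidem eqxx andbT.
by rewrite subrr radF0.
Qed.

(** Membership in the ideals [col_ideal t] bounds the radical from above; quasi-regularity of the
    single entries bounds it from below. *)
Lemma rad_hereditary M : (M \in Defs.rad H) <-> diag_rad M.
Proof.
split=> [/radP Mr s t st|/diag_rad_quasi_regular/quasi_regular_rad //].
exact: (Mr _ (col_ideal_maximal t)).
Qed.

Lemma rad_sub1_invertible (x : H) : x \in Defs.rad H -> invertible (1 - x).
Proof. by move/rad_hereditary/diag_rad_quasi_regular/quasi_regular_sub1_unit. Qed.

Lemma radF_rad (a : subring_of O) :
  (a \in Defs.rad (subring_of O)) = (val a \in radF O).
Proof.
apply/idP/asboolP => [ar|[b br ba]]; first by exists a.
by rewrite -(val_inj ba).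
Qed.

Lemma valOD (x y : subring_of O) : val (x + y) = val x + val y.
Proof. exact: rmorphD. Qed.

Lemma valOB (x y : subring_of O) : val (x - y) = val x - val y.
Proof. exact: rmorphB. Qed.

Lemma valOM (x y : subring_of O) : val (x * y) = val x * val y.
Proof. exact: rmorphM. Qed.

Lemma residue_eq x y : x \in O -> y \in O ->
  residue O x = residue O y <-> x - y \in radF O.
Proof. by move=> xO yO; rewrite /residue modrad_eq radF_rad valOB !insubdK. Qed.

Lemma residueD x y : x \in O -> y \in O ->
  residue O (x + y) = residue O x + residue O y.
Proof.
move=> xO yO; rewrite /residue -modradD; congr modrad; apply: val_inj.
by rewrite valOD !insubdK // rpredD.
Qed.

Lemma residueB x y : x \in O -> y \in O ->
  residue O (x - y) = residue O x - residue O y.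
Proof.
move=> xO yO; apply: (addIr (residue O y)).
by rewrite subrK -residueD ?subrK // rpredB.
Qed.

Lemma residueM x y : x \in O -> y \in O ->
  residue O (x * y) = residue O x * residue O y.
Proof.
move=> xO yO; rewrite /residue -[RHS]modradM; congr modrad; apply: val_inj.
by rewrite valOM !insubdK // rpredM.
Qed.

Lemma residue1 : residue O 1 = 1.
Proof.
by rewrite /residue -[RHS]/(modrad 1); congr modrad; apply: val_inj;
  rewrite insubdK ?rpred1.
Qed.

Lemma residue0 : residue O 0 = 0.
Proof. by rewrite -[0 in LHS](subrr 0) residueB ?rpred0 // subrr. Qed.

Lemma residue_sum (I : Type) (l : seq I) (P : pred I) (x : I -> F) :
  (forall i, x i \in O) ->
  residue O (\sum_(i <- l | P i) x i) = \sum_(i <- l | P i) residue O (x i).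
Proof.
(* [residue] is additive only on [O], so the induction carries membership in [O] along. *)
move=> xO; pose Kr y z := y \in O /\ residue O y = z.
suff [] : Kr (\sum_(i <- l | P i) x i) (\sum_(i <- l | P i) residue O (x i)) by [].
apply: (big_ind2 Kr) => [|y z y' z' [yO <-] [yO' <-]|i _].
- by split; rewrite ?rpred0 ?residue0.
- by split; rewrite ?rpredD ?residueD.
by split.
Qed.

Lemma diag_residueE (M : H) i a b :
  diag_residue M i a b = residue O (val M (Rank i a) (Rank i b)).
Proof. by rewrite !mxE. Qed.

Lemma diag_residue_eq (M M' : H) :
  diag_residue M = diag_residue M' <-> M - M' \in Defs.rad H.
Proof.
rewrite rad_hereditary; split=> [eMM s t st|dMM].
  have := congr1 (fun z : block_prod _ _ => z (blk t)) eMM.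
  have hs : exists a : 'I_(p (blk t)), Rank (blk t) a = s.
    by rewrite -st; exists (sig2 s); rewrite sig2K.
  have [a <-] := hs; move=> /matrixP/(_ a (sig2 t)).
  rewrite !diag_residueE sig2K => /residue_eq; rewrite val_entryB; apply.
    exact: Hent_order (Hent_val _ _ _).
  exact: Hent_order (Hent_val _ _ _).
apply: functional_extensionality_dep => i; apply/matrixP => a b.
rewrite !diag_residueE; apply/residue_eq; try exact: Hent_order (Hent_val _ _ _).
by rewrite -val_entryB; apply: dMM; rewrite !Rank1K.
Qed.

Lemma theta_modrad (M : H) : theta (modrad M) = diag_residue M.
Proof. by apply/diag_residue_eq/modrad_eq; rewrite modrad_repr. Qed.

Lemma theta_zmod : zmod_morphism (@theta F O r p).
Proof.
move=> x y; rewrite -[x]modrad_repr -[y]modrad_repr.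
have -> : modrad (repr x) - modrad (repr y) = modrad (repr x - repr y).
  apply: (addIr (modrad (repr y))); by rewrite subrK -modradD subrK.
rewrite !theta_modrad.
apply: functional_extensionality_dep => i; apply/matrixP => a b.
have -> : (diag_residue (repr x) - diag_residue (repr y)) i a b =
  diag_residue (repr x) i a b - diag_residue (repr y) i a b by rewrite !mxE.
rewrite !diag_residueE val_entryB residueB //; exact: Hent_order (Hent_val _ _ _).
Qed.

Lemma theta_monoid : monoid_morphism (@theta F O r p).
Proof.
split.
  rewrite -[1]/(modrad 1) theta_modrad.
  apply: functional_extensionality_dep => i; apply/matrixP => a b.
  rewrite diag_residueE val_entry1 -[RHS]/((1%:M : 'M_(p i)) a b) mxE.
  rewrite -val_eqE eq_Rank eqxx /= -val_eqE.
  by case: (_ == _); rewrite ?residue1 ?residue0.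
move=> x y; rewrite -[x]modrad_repr -[y]modrad_repr.
rewrite -[modrad _ * modrad _]modradM !theta_modrad.
apply: functional_extensionality_dep => i; apply/matrixP => a b.
rewrite diag_residueE val_entryM.
rewrite -[RHS]/((diag_residue _ i *m diag_residue _ i) a b) mxE.
have xO s t := Hent_order (Hent_val (repr x) s t).
have yO s t := Hent_order (Hent_val (repr y) s t).
rewrite residue_sum => [|k]; last exact: rpredM.
rewrite sum_blocks.
(* A product through another block [i'] vanishes in the residue: one of its two factors lies above
   the block diagonal, hence in the radical. *)
rewrite (bigD1 i) //= [X in _ + X]big1 ?addr0 => [|i' ne]; last first.
  rewrite big1 // => j _; rewrite -residue0.
  apply/residue_eq; rewrite ?rpred0 ?rpredM //.
  rewrite subr0; have := Hent_val (repr x) (Rank i a) (Rank i' j).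
  have := Hent_val (repr y) (Rank i' j) (Rank i b); rewrite /Hent !Rank1K.
  case: leqP => [le_ii' _|_ yr _]; last exact: radFMl.
  case: leqP => [le_i'i|_ xr]; last exact: radFMr.
  by case/eqP: ne; apply: val_inj; apply/eqP; rewrite eqn_leq le_i'i.
by apply: eq_bigr => j _; rewrite residueM // !diag_residueE.
Qed.

Lemma mkH_diag (B : forall i, 'M[F]_(p i)) :
  (forall i a b, B i a b \in O) ->
  forall i a b, val (mkH O (\mxdiag_i B i)) (Rank i a) (Rank i b) = B i a b.
Proof.
move=> BO i a b; rewrite mkHK => [|s t].
  by have /matrixP/(_ a b) := submxblock_diag B i; rewrite !mxE.
rewrite mxE /Hent; case: (eqVneq (blk s) (blk t)) => [st|ne]; last first.
  by rewrite mxE; case: ifP => _; rewrite ?rpred0 // radF0.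
move: (sig2 s) (sig2 t); rewrite st => c d; rewrite leqnn conform_mx_id.
exact: BO.
Qed.

Lemma theta_inj : injective (@theta F O r p).
Proof.
move=> x y; rewrite -[x]modrad_repr -[y]modrad_repr !theta_modrad.
by move/diag_residue_eq/modrad_eq.
Qed.

Lemma theta_bij : bijective (@theta F O r p).
Proof.
have surj z : exists y, @theta F O r p y = z.
  pose M := mkH O (\mxdiag_i map_mx (fun c : Obar O => val (repr c)) (z i)).
  exists (modrad M); rewrite theta_modrad.
  apply: functional_extensionality_dep => i; apply/matrixP => a b.
  rewrite diag_residueE mkH_diag => [|i' a' b']; last by rewrite mxE; apply: valP.
  by rewrite mxE /residue valKd modrad_repr.
have [g gP] := choice surj; exists g => // y.
by apply: theta_inj; rewrite gP.
Qed.

End HereditaryRadical.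

(** * Automorphisms permuting the diagonal idempotents *)

Lemma inj_surj_bij (T U : Type) (f : T -> U) :
  injective f -> (forall y, exists x, f x = y) -> bijective f.
Proof.
by move=> fI /choice[g gK]; exists g => // x; apply: fI.
Qed.

Section RingAut.
Variables (A : pzRingType) (f : A -> A).
Hypothesis fA : ring_aut f.

Lemma ring_autB x y : f (x - y) = f x - f y.
Proof. by case: fA. Qed.

Lemma ring_aut0 : f 0 = 0.
Proof. by rewrite -[in LHS](subrr 0) ring_autB subrr. Qed.

Lemma ring_autD x y : f (x + y) = f x + f y.
Proof. by rewrite -{1}[y]opprK -[- y]sub0r !ring_autB ring_aut0 sub0r opprK. Qed.

Lemma ring_autM x y : f (x * y) = f x * f y.
Proof. by case: fA => _ [_ fM] _; apply: fM. Qed.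

Lemma ring_aut1 : f 1 = 1.
Proof. by case: fA => _ [f1 _] _. Qed.

Lemma ring_aut_inj : injective f.
Proof. by case: fA => _ _; apply: bij_inj. Qed.

Lemma ring_aut_surj y : exists x, f x = y.
Proof. by case: fA => _ _ [g _ gK]; exists (g y). Qed.

End RingAut.

Section RingAutGroup.
Variable A : pzRingType.
Implicit Types f g : A -> A.

Lemma ring_aut_id : ring_aut (@id A).
Proof. by split=> //; exists id. Qed.

Lemma ring_aut_comp f g : ring_aut f -> ring_aut g -> ring_aut (f \o g).
Proof.
move=> fA gA; split=> [x y|//|].
- by rewrite /= (ring_autB gA) (ring_autB fA).
- split=> [|x y] /=; first by rewrite (ring_aut1 gA) (ring_aut1 fA).
  by rewrite (ring_autM gA) (ring_autM fA).
by apply: bij_comp; [case: fA | case: gA].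
Qed.

Lemma ring_aut_inv f g : ring_aut f -> cancel f g -> cancel g f -> ring_aut g.
Proof.
move=> fA fK gK; split=> [x y|//|]; last by exists f.
- by apply: (ring_aut_inj fA); rewrite (ring_autB fA) !gK.
split=> [|x y]; apply: (ring_aut_inj fA); first by rewrite gK (ring_aut1 fA).
by rewrite (ring_autM fA) !gK.
Qed.

Lemma inner_ring_aut f : inner f -> ring_aut f.
Proof.
move=> [u [v [[uv vu] fE]]]; split.
- by move=> x y; rewrite !fE mulrBr mulrBl.
- split; first by rewrite fE mulr1.
  by move=> x y; rewrite !fE !mulrA -(mulrA _ v u) vu mulr1.
by exists (fun x => v * x * u) => x;
  rewrite !fE !mulrA ?vu ?uv mul1r -mulrA ?vu ?uv mulr1.
Qed.

Lemma ring_aut_local_corner f x :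
  ring_aut f -> local_corner x -> local_corner (f x).
Proof.
move=> fA [xx x0 loc]; have fM := ring_autM fA; split.
- by rewrite -fM xx.
- by rewrite -(ring_aut0 fA) (inj_eq (ring_aut_inj fA)).
move=> y' [fy yf]; have [y ey] := ring_aut_surj fA y'; rewrite -{y'}ey in fy yf *.
have cy : corner x y by split; apply: (ring_aut_inj fA); rewrite fM.
have tr z : corner_unit x z -> corner_unit (f x) (f z).
  move=> [c [[xc cx] zc cz]]; exists (f c); rewrite -!fM zc cz.
  by split=> //; split; rewrite -fM ?xc ?cx.
by case: (loc y cy) => /tr; [left | right; rewrite -(ring_autB fA)].
Qed.

End RingAutGroup.

(** * Valuations as exponents of [w] *)

Section Valuation.
Variables (F : unitRingType) (O : subringClosed F) (w : subring_of O).
Hypothesis V : valuation_order w.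
Local Notation W := (val w).

(** The valuation is kept as a relation, which also asserts that the value is a natural number;
    uniqueness is [hasval_uniq]. *)
Definition hasval k (x : F) := exists2 c, ounit O c & x = W ^+ k * c.

Let Wu : W \is a GRing.unit.
Proof. by case: (V) => hF _ _ _; apply: hF; apply: uniformizer_neq0 V. Qed.

Lemma ounit_conjX k c : ounit O c -> exists2 d, ounit O d & c * W ^+ k = W ^+ k * d.
Proof.
elim: k c => [|k IH] c uc; first by exists c => //; rewrite mulr1 mul1r.
have /and3P[_ cO cV] := uc; have cu := ounit_unit V uc.
have ud : ounit O (W^-1 * c * W).
  apply: (mulr1_ounit V (conj_wV V cO) (conj_wV V cV)).
  by rewrite !mulrA mulrK // mulrK // mulVr.
have [d' ud' e] := IH _ ud; exists d' => //.
by rewrite exprS -!mulrA -e !mulrA divrr // mul1r.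
Qed.

Lemma hasvalM k l x y : hasval k x -> hasval l y -> hasval (k + l) (x * y).
Proof.
move=> [c uc ->] [d ud ->]; have [c' uc' e] := ounit_conjX l uc.
exists (c' * d); first exact: (ounitM V).
by rewrite exprD !mulrA -(mulrA _ c) e !mulrA.
Qed.

Lemma hasval_le k l x : hasval k x -> hasval l x -> (l <= k)%N.
Proof.
move=> [c uc ->] [d ud e]; rewrite leqNgt; apply/negP => /subnKC lt_kl.
have dO := ounit_order ud.
have : c \in radF O.
  apply/(radFPl V); exists (W ^+ (l - k.+1) * d).
    by rewrite rpredM // rpredX // (valP w).
  by apply: (mulrI (unitrX k Wu)); rewrite e -{1}lt_kl addSnnS exprD exprS !mulrA.
by rewrite (radF_nonunit V) uc andbF.
Qed.

Lemma hasval_uniq k l x : hasval k x -> hasval l x -> k = l.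
Proof.
by move=> kx lx; apply/eqP; rewrite eqn_leq (hasval_le lx kx) (hasval_le kx lx).
Qed.

(** A criterion for generators: if [W ^+ k * a] generates the right module [W ^+ k * O], then [a] is
    a unit. *)
Lemma hasval_gen k a c : a \in O -> c \in O -> W ^+ k = W ^+ k * a * c ->
  hasval k (W ^+ k * a).
Proof.
move=> aO cO e; exists a => //; apply: (mulr1_ounit V aO cO).
by apply: (mulrI (unitrX k Wu)); rewrite mulrA -e mulr1.
Qed.

End Valuation.

(** * Automorphisms that permute the diagonal idempotents are monomial *)

Section Monomial.
Variables (F : unitRingType) (O : subringClosed F) (w : subring_of O).
Hypothesis V : valuation_order w.
Variables (r : nat) (p : 'I_r -> nat).
Local Notation N := (\sum_i p i)%N.
Local Notation H := (Hord O p).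
Local Notation blk := (@sig1 r p).
Local Notation W := (val w).
Implicit Types (s t : 'I_N).

Lemma ring_aut_permutes_hidem (f : H -> H) : ring_aut f ->
  exists (u v : H) (pi : 'I_N -> 'I_N),
    mutual_inverse u v /\ forall s, u * f (hidem O s) * v = hidem O (pi s).
Proof.
move=> fA.
have := @krull_schmidt H N (@hidem F O r p) (fun s => f (hidem O s)); apply.
- exact: (hidem_local V).
- exact: hidem_sum.
- by move=> i j; apply: hidem_orth.
- by move=> i; apply: (ring_aut_local_corner fA); apply: (hidem_local V).
by move=> i j ne; rewrite -(ring_autM fA) hidem_orth // ring_aut0.
Qed.

Variables (f : H -> H) (pi : 'I_N -> 'I_N) (s0 : 'I_N).
Hypothesis fA : ring_aut f.
Hypothesis f_hidem : forall s, f (hidem O s) = hidem O (pi s).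
Hypothesis s0_min : forall s, (blk s0 <= blk s)%N.

Lemma permutation_inj : injective pi.
Proof.
move=> s t st; apply/eqP; apply: contraTT isT => ne.
have := hidem_neq0 O (pi s); rewrite -(hidem_idem O (pi s)) {2}st -!f_hidem.
by rewrite -(ring_autM fA) hidem_orth // (ring_aut0 fA) eqxx.
Qed.

(** The map that [f] induces from the entries at (s, t) to those at (pi s, pi t); it is onto by
    [phi_surj] and multiplicative along composable positions by [phiM]. *)
Let phi s t x := val (f (hdelta O s t x)) (pi s) (pi t).

Let phiE (M : H) s t : phi s t (val M s t) = val (f M) (pi s) (pi t).
Proof.
rewrite /phi -hidemMhidem !(ring_autM fA) !f_hidem hidemMhidem.
by rewrite val_entry_hdelta ?eqxx //; apply: Hent_val.
Qed.

Let f_hdelta s t x : Hent O s t x ->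
  f (hdelta O s t x) = hdelta O (pi s) (pi t) (phi s t x).
Proof.
move=> hx; rewrite -hidemMhidem -/(phi s t x).
have e : hidem O s * hdelta O s t x * hidem O t = hdelta O s t x.
  by rewrite hidemMhidem val_entry_hdelta ?eqxx.
by rewrite -{1}e !(ring_autM fA) !f_hidem.
Qed.

Let phi_Hent s t x : Hent O (pi s) (pi t) (phi s t x).
Proof. exact: Hent_val. Qed.

Let phi_surj s t y : Hent O (pi s) (pi t) y ->
  exists2 x, Hent O s t x & phi s t x = y.
Proof.
move=> hy; have [M eM] := ring_aut_surj fA (hdelta O (pi s) (pi t) y).
exists (val M s t); first exact: Hent_val.
by rewrite phiE eM val_entry_hdelta ?eqxx.
Qed.

Let phiM s t t' x y : Hent O s t x -> Hent O t t' y ->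
  phi s t' (x * y) = phi s t x * phi t t' y.
Proof.
move=> hx hy; rewrite {1}/phi -(hdeltaM hx hy) (ring_autM fA).
rewrite (f_hdelta hx) (f_hdelta hy) hdeltaM //.
by rewrite val_entry_hdelta ?eqxx //; apply: HentM.
Qed.

(** Since [s0] lies in the first block, its column admits all of [O]; in particular 1 is an
    admissible entry at (s, s0), and its image will be the factor [u s]. *)
Let Hent_s0 s x : x \in O -> Hent O s s0 x.
Proof. by rewrite /Hent s0_min. Qed.

(* The entries of [f] satisfy [phi s t x * u t = u s * sigma x] with [u s] the
   image of the entry 1 at position [(s, s0)]; the last clause compares the
   valuations of both sides when [x] generates the entries at [(s, t)]. *)
Lemma monomial_form : exists2 sigma : subring_of O -> subring_of O, ring_aut sigma &
  exists u : 'I_N -> F,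
  [/\ forall (M : H) s t a, val M s t = val a ->
        val (f M) (pi s) (pi t) * u t = u s * val (sigma a),
      forall s, hasval w (blk (pi s) < blk (pi s0))%N (u s)
    & forall s t, ((blk (pi s) < blk (pi t)) + (blk (pi t) < blk (pi s0)) =
        (blk (pi s) < blk (pi s0)) + (blk s < blk t))%N].
Proof.
have phiO x : phi s0 s0 x \in O by exact: Hent_order (phi_Hent _ _ _).
pose sigma (a : subring_of O) : subring_of O := SubringOf (phiO (val a)).
have sigE a : val (sigma a) = phi s0 s0 (val a) by [].
have aO (a : subring_of O) s : Hent O s s0 (val a) by apply: Hent_s0; apply: valP.
have sigmaA : ring_aut sigma.
  split.
  - move=> a b; apply: val_inj; rewrite valOB !sigE valOB.
    have B : hdelta O s0 s0 (val a - val b) =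
        hdelta O s0 s0 (val a) - hdelta O s0 s0 (val b).
      apply: (addIr (hdelta O s0 s0 (val b))); rewrite subrK -hdeltaD ?subrK //.
      by apply: HentD => //; apply: HentN.
    by rewrite /phi B (ring_autB fA) val_entryB.
  - split=> [|a b]; apply: val_inj.
      by rewrite sigE [val 1]rmorph1 /phi f_hidem val_entry_hidem eqxx.
    by rewrite valOM !sigE valOM (phiM (aO a s0) (aO b s0)).
  apply: inj_surj_bij => [a b /(congr1 val)|b].
    rewrite !sigE => ab.
    have := f_hdelta (aO a s0); rewrite ab -(f_hdelta (aO b s0)).
    move/(ring_aut_inj fA)/(congr1 (fun M : H => val M s0 s0)).
    by rewrite !val_entry_hdelta // !eqxx; apply: val_inj.
  have [x hx xb] := phi_surj (Hent_diag (pi s0) (valP b)).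
  have xO : x \in O by apply: Hent_order hx.
  by exists (SubringOf xO); apply: val_inj; rewrite sigE.
exists sigma => //; exists (fun s => phi s s0 1).
have sO1 s : Hent O s s0 1 by apply: Hent_s0; rewrite rpred1.
have form s t x : Hent O s t x ->
    phi s t x * phi t s0 1 = phi s s0 1 * phi s0 s0 x.
  move=> hx; have hx0 : Hent O s0 s0 x by apply/Hent_s0/Hent_order/hx.
  by rewrite -(phiM hx (sO1 t)) -(phiM (sO1 s) hx0) mulr1 mul1r.
have hW s t : Hent O s t (W ^+ (blk s < blk t)%N).
  by apply/(HentP V); exists 1; rewrite ?rpred1 ?mulr1.
(* [phi] carries a generator of the entries at (s, t) to a generator of those at (pi s, pi t): the
   preimage of the standard generator there is a right multiple of the one at (s, t). *)
have gen s t :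
    hasval w (blk (pi s) < blk (pi t))%N (phi s t (W ^+ (blk s < blk t)%N)).
  have [x hx ex] := phi_surj (hW (pi s) (pi t)).
  have /(HentP V)[a aO' ea] := phi_Hent s t (W ^+ (blk s < blk t)%N).
  have /(HentP V)[b bO eb] := hx; rewrite ea.
  apply: (hasval_gen V aO' (Hent_order (phi_Hent t t b))).
  by rewrite -ea -(phiM (hW s t) (Hent_diag t bO)) -eb ex.
(* [sigma] and its inverse preserve the radical of [O], so [sigma w] still generates it and has
   valuation 1. *)
have val_sigma (k : bool) : hasval w k (phi s0 s0 (W ^+ k)).
  case: k; last first.
    exists 1; first exact: ounit1.
    by rewrite mul1r expr0 /phi f_hidem val_entry_hidem eqxx.
  rewrite expr1.
  have wr : w \in Defs.rad (subring_of O) by rewrite radF_rad (radF_w V).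
  have : sigma w \in Defs.rad (subring_of O) by apply: ring_aut_rad.
  rewrite radF_rad => /(radFPl V)[a aO' ea]; rewrite sigE in ea.
  have [z ez] := ring_aut_surj sigmaA w.
  have : z \in Defs.rad (subring_of O).
    have [_ _ [g gK Kg]] := sigmaA; rewrite -(gK z) ez.
    by apply: ring_aut_rad => //; apply: ring_aut_inv sigmaA gK Kg.
  rewrite radF_rad => /(radFPl V)[b bO eb].
  rewrite ea; apply: (hasval_gen (k := 1) V aO' (phiO b)).
  rewrite expr1 -ea -(phiM (Hent_diag s0 (valP w)) (Hent_diag s0 bO)) -eb.
  by rewrite -sigE ez.
split=> [M s t a Ma|s|s t].
- rewrite sigE -Ma -phiE form //; exact: Hent_val.
- have := gen s s0; rewrite [X in W ^+ X](_ : _ = 0%N) //.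
  by rewrite ltnNge s0_min.
apply: (hasval_uniq V (x := phi s t (W ^+ (blk s < blk t)%N) * phi t s0 1)).
  apply: (hasvalM V); first exact: gen.
  have := gen t s0; rewrite [X in W ^+ X](_ : _ = 0%N) //.
  by rewrite ltnNge s0_min.
rewrite form //; apply: (hasvalM V); last exact: val_sigma.
have := gen s s0; rewrite [X in W ^+ X](_ : _ = 0%N) //.
by rewrite ltnNge s0_min.
Qed.

End Monomial.

(** * The induced permutation of the blocks is a rotation *)

Lemma sum_ltn_ord r m : (m <= r)%N -> (\sum_(j < r) (j < m) = m)%N.
Proof.
move=> le_mr; rewrite -(subnKC le_mr) big_split_ord /=.
rewrite (eq_bigr (fun=> 1%N)) => [|j _]; last by rewrite ltn_ord.
rewrite sum1_card card_ord big1 ?addn0 // => j _.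
by rewrite ltnNge leq_addr.
Qed.

(** Extended to a function [P] on [nat], the sizes are invariant under shifts by [t] and [b], hence
    by [gcdn t b]. This gcd divides [r], so it is a period, and minimality gives [gcdn t b = t]. *)
Lemma minimal_period_dvd (r : nat) (p : 'I_r -> nat) t b :
    (0 < r)%N -> minimal_period p t ->
    (forall i j : 'I_r, (j = i + b %[mod r])%N -> p j = p i) -> (t %| b)%N.
Proof.
move=> r0 [[t0 tr tp] tmin] bp.
pose P k := p (Ordinal (ltn_pmod k r0)).
have Pb k : P (k + b)%N = P k.
  by apply: bp; rewrite /= modnDml modn_mod.
have Pt k : P (k + t)%N = P k.
  by apply: tp; rewrite /= !modn_dvdm // modnDr.
have Pmul a c k : (forall k, P (k + c)%N = P k) -> P (k + a * c)%N = P k.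
  by move=> Pc; elim: a => [|a IH]; rewrite ?addn0 // mulSn addnCA addnC Pc.
have dvd_gt : (gcdn t b %| t)%N := dvdn_gcdl t b.
have Pg k : P (k + gcdn t b)%N = P k.
  have [km kn e _] := egcdnP b t0.
  by rewrite -(Pmul kn b) // addnAC -addnA -e Pmul.
have /tmin le_tg : period p (gcdn t b).
  split; [by rewrite gcdn_gt0 t0 | exact: dvdn_trans dvd_gt tr |].
  have PE (i : 'I_r) : P i = p i by congr p; apply: val_inj; rewrite /= modn_small.
  suff H (i j : 'I_r) : (i <= j)%N -> (i = j %[mod gcdn t b])%N -> p i = p j.
    by move=> i j ij; case: (leqP i j) => [/H|/ltnW/H/(_ (esym ij))]; [apply |].
  move=> le_ij /esym/eqP; rewrite eqn_mod_dvd // => /dvdnP[a e].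
  by rewrite -!PE -(subnKC le_ij) e Pmul.
have /eqP <- : gcdn t b == t by rewrite eqn_leq le_tg dvdn_leq.
exact: dvdn_gcdr.
Qed.

Section BlockRotation.
Variables (r : nat) (p : 'I_r -> nat).
Hypothesis hp : forall i, (0 < p i)%N.
Local Notation N := (\sum_i p i)%N.
Local Notation blk := (@sig1 r p).
Variables (pi : 'I_N -> 'I_N) (s0 : 'I_N).
Hypothesis pi_inj : injective pi.
Hypothesis pi_blk : forall s t,
  ((blk (pi s) < blk (pi t)) + (blk (pi t) < blk (pi s0)) =
   (blk (pi s) < blk (pi s0)) + (blk s < blk t))%N.

Let rep (k : 'I_r) : 'I_N := Rank k (Ordinal (hp k)).

Let rep_blk k : blk (rep k) = k.
Proof. exact: Rank1K. Qed.

(** Adding [pi_blk] for (s, t) and for (t, s) cancels the comparisons with [s0]. *)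
Let pi_blk_eq s t : (blk (pi s) == blk (pi t)) = (blk s == blk t).
Proof.
have := pi_blk s t; have := pi_blk t s; rewrite -!val_eqE /=.
by case: ltngtP => _; case: ltngtP => _; do ?case: ltngtP => _.
Qed.

(* Sum [pi_blk] over one index in each block. *)
Lemma block_rotation s : blk (pi s) = ((blk s + blk (pi s0)) %% r)%N :> nat.
Proof.
pose beta k := blk (pi (rep k)).
have beta_inj : injective beta.
  by move=> k l /eqP; rewrite pi_blk_eq !rep_blk => /eqP.
have sum_beta m : (m <= r)%N -> (\sum_j (beta j < m) = m)%N.
  move=> le_mr; rewrite -[RHS](sum_ltn_ord le_mr).
  by rewrite [RHS](reindex_inj beta_inj).
have : (\sum_(j < r) ((beta j < blk (pi s)) + (blk (pi s) < blk (pi s0))) =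
        \sum_(j < r) ((beta j < blk (pi s0)) + (j < blk s)))%N.
  by apply: eq_bigr => j _; rewrite pi_blk rep_blk.
(* The sums evaluate to [blk (pi s) + r * c = blk (pi s0) + blk s], with [c] the truth value of
   [blk (pi s) < blk (pi s0)]; it remains to reduce modulo [r]. *)
rewrite !big_split /= !sum_beta ?sum_ltn_ord ?(ltnW (ltn_ord _)) //.
rewrite sum_nat_const card_ord mulnC addnC => e.
by rewrite addnC -e modnMDl modn_small.
Qed.

Lemma card_block k : #|[set s : 'I_N | blk s == k]%SET| = p k.
Proof.
rewrite -sum1dep_card big_mkcond /= sum_blocks (bigD1 k) //=.
rewrite [X in _ + X]big1 ?addr0 => [|i ne]; last first.
  by rewrite big1 // => j _; rewrite Rank1K (negPf ne).
rewrite (eq_bigr (fun=> 1%N)) => [|j _]; last by rewrite Rank1K eqxx.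
by rewrite -[LHS]/(\sum_(j < p k) 1)%N sum1_card card_ord.
Qed.

Lemma block_rotation_size s : p (blk (pi s)) = p (blk s).
Proof.
rewrite -!card_block -(on_card_preimset (f := pi)); last first.
  by apply: onW_bij; apply: injF_bij.
by apply: eq_card => u; rewrite !inE pi_blk_eq.
Qed.

Lemma block_rotation_period t : (0 < r)%N -> minimal_period p t ->
  (t %| blk (pi s0))%N.
Proof.
move=> r0 /(minimal_period_dvd r0); apply => i j ji.
rewrite -(rep_blk i) -block_rotation_size; congr p; apply: val_inj => /=.
by rewrite block_rotation rep_blk -ji modn_small.
Qed.

End BlockRotation.

(** * The matrix rho *)

Section MonomialMatrix.
Variables (F : unitRingType) (N : nat) (tau : 'I_N -> 'I_N) (c : 'I_N -> F).
Hypothesis tau_inj : injective tau.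

Definition monomial_mx : 'M[F]_N := \matrix_(m, n) if m == tau n then c n else 0.

Definition monomial_inv : 'M[F]_N :=
  \matrix_(m, n) if n == tau m then (c m)^-1 else 0.

Lemma mul_monomial_mx (X : 'M[F]_N) i j :
  (monomial_mx *m X) (tau i) j = c i * X i j.
Proof.
rewrite mxE (bigD1 i) //= [X in _ + X]big1 ?addr0 ?mxE ?eqxx // => k ki.
by rewrite mxE (inj_eq tau_inj) eq_sym (negPf ki) mul0r.
Qed.

Lemma mul_mx_monomial (X : 'M[F]_N) i j :
  (X *m monomial_mx) i j = X i (tau j) * c j.
Proof.
rewrite mxE (bigD1 (tau j)) //= [X in _ + X]big1 ?addr0 ?mxE ?eqxx // => k ki.
by rewrite mxE (negPf ki) mulr0.
Qed.

Lemma permuted_rows (X Y : 'M[F]_N) :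
  (forall i j, X (tau i) j = Y (tau i) j) -> X = Y.
Proof.
have [tau' _ tauK] := injF_bij tau_inj.
by move=> XY; apply/matrixP => i j; rewrite -(tauK i).
Qed.

Hypothesis cU : forall i, c i \is a GRing.unit.

Lemma monomial_mulV : mutual_inverse monomial_mx monomial_inv.
Proof.
split.
  apply: permuted_rows => i j; rewrite [LHS]mul_monomial_mx !mxE eq_sym.
  by case: eqP; rewrite ?divrr ?mulr0.
apply/matrixP => i j; rewrite [LHS]mul_mx_monomial !mxE (inj_eq tau_inj) eq_sym.
by case: eqP => [->|]; rewrite ?mulVr ?mul0r.
Qed.

End MonomialMatrix.

Section AdMonomial.
Variables (F : unitRingType) (N : nat) (S : subringClosed 'M[F]_N).
Variables (tau : 'I_N -> 'I_N) (c : 'I_N -> F).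
Hypotheses (tau_inj : injective tau) (cU : forall i, c i \is a GRing.unit).

(** Conjugation in the form [f x * g = g * x], read entrywise, which avoids the inverse matrix. *)
Lemma Ad_monomialP (f : subring_of S -> subring_of S) :
  Ad (monomial_mx tau c) f <->
  forall x i j, val (f x) (tau i) (tau j) * c j = c i * val x i j.
Proof.
split=> [[g [[_ g1] fE]] x i j|fE].
  rewrite -mul_mx_monomial -(mul_monomial_mx c tau_inj).
  have -> // : val (f x) *m monomial_mx tau c = monomial_mx tau c *m val x.
  by rewrite fE -[LHS]mulrA g1 [LHS]mulr1.
have [e1 e2] := monomial_mulV tau_inj cU; exists (monomial_inv tau c); split=> // x.
rewrite -[LHS]mulr1 -e1 mulrA; congr (_ * _).
apply: (permuted_rows tau_inj) => i j.
by rewrite [LHS]mul_mx_monomial [RHS]mul_monomial_mx.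
Qed.

End AdMonomial.

Lemma eqn_divmod q m k : (m == k) = (m %/ q == k %/ q)%N && (m == k %[mod q])%N.
Proof.
apply/eqP/andP => [->|[/eqP ed /eqP em]]; first by rewrite !eqxx.
by rewrite (divn_eq m q) (divn_eq k q) ed em.
Qed.

Lemma leq_addq_mul l q n : (0 < q)%N -> (n < l * q)%N ->
  (l * q <= n + q)%N = (n %/ q == l.-1)%N.
Proof.
case: l => [|l] // q0 lt; rewrite mulSn addnC leq_add2r /= -leq_divRL //.
by rewrite eqn_leq andb_idl // => _; rewrite -ltnS ltn_divLR.
Qed.

(** Cutting [l * q] rows into [l] strips of height [q], the shift by [q] moves each strip to the
    next one, cyclically. *)
Lemma divn_shift l q n : (0 < q)%N -> (n < l * q)%N ->
  ((n + q) %% (l * q) %/ q = if n %/ q == l.-1 then 0 else (n %/ q).+1)%N.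
Proof.
move=> q0 lt; rewrite -leq_addq_mul //; case: ltnP => [small|big].
  by rewrite modn_small // divnDr ?dvdnn // divnn q0 addn1.
have lt' : (n + q - l * q < q)%N by rewrite ltn_subLR // ltn_add2r.
rewrite -(subnK big) modnDr modn_small ?divn_small //.
by apply: leq_trans lt' _; case: l lt {big} => // l _; rewrite mulSn leq_addr.
Qed.

Section Rho.
Variables (F : unitRingType) (O : subringClosed F) (w : subring_of O).
Hypothesis V : valuation_order w.
Variables (r : nat) (p : 'I_r -> nat).
Hypotheses (r_gt0 : (0 < r)%N) (hp : forall i, (0 < p i)%N).
Variable t : nat.
Hypothesis ht : period p t.
Local Notation N := (\sum_i p i)%N.
Local Notation H := (Hord O p).
Local Notation blk := (@sig1 r p).
Local Notation W := (val w).
Local Notation q := (\sum_(i < r | (i < t)%N) p i)%N.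

Let t_gt0 : (0 < t)%N. Proof. by case: ht. Qed.
Let t_dvd : (t %| r)%N. Proof. by case: ht. Qed.
Let t_le : (t <= r)%N. Proof. by rewrite dvdn_leq. Qed.

(** [P] continues the block sizes periodically, and [S k] is the first row of block [k], also for
    [k] beyond [r]. Shifts can thus be computed before reducing blocks modulo [r] and rows modulo
    [N]. *)
Let P k := p (Ordinal (ltn_pmod k r_gt0)).
Let S m := (\sum_(0 <= k < m) P k)%N.

Let P_ord (i : 'I_r) : P i = p i.
Proof. by congr p; apply: val_inj; rewrite /= modn_small. Qed.

Let PDt k : P (k + t)%N = P k.
Proof.
case: ht => _ _ tp; apply: tp; rewrite /= !modn_dvdm //.
by rewrite modnDr.
Qed.

Let PDr k : P (k + r)%N = P k.
Proof. by congr p; apply: val_inj; rewrite /= modnDr. Qed.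

Let S_ord m : (m <= r)%N -> (\sum_(i < r | (i < m)%N) p i)%N = S m.
Proof.
move=> le_mr; rewrite /S (big_nat_widen 0 m r) // big_mkord.
by apply: eq_bigr => i _; rewrite P_ord.
Qed.

Let S_q : q = S t. Proof. exact: S_ord. Qed.

Let S_N : N = S r.
Proof. by rewrite -S_ord //; apply: eq_bigl => i; rewrite ltn_ord. Qed.

Let SD m d : (forall k, P (k + d)%N = P k) -> S (m + d)%N = (S d + S m)%N.
Proof.
move=> Pd; rewrite {1}/S (big_cat_nat (n := d)) ?leq_addl //=; congr (_ + _)%N.
rewrite -{1}[d]add0n big_addn addnK.
by apply: eq_bigr => i _.
Qed.

Let SDt m : S (m + t)%N = (q + S m)%N. Proof. by rewrite SD // S_q. Qed.
Let SDr m : S (m + r)%N = (N + S m)%N. Proof. by rewrite SD // S_N. Qed.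

Let N_q : N = (r %/ t * q)%N.
Proof.
rewrite S_N -{1}(divnK t_dvd); elim: (r %/ t)%N => [|l IH].
  by rewrite /S big_geq.
by rewrite mulSn addnC SDt IH mulSn.
Qed.

Let q_gt0 : (0 < q)%N.
Proof.
rewrite (bigD1 (Ordinal r_gt0)) //=; apply: leq_trans (leq_addr _ _); exact: hp.
Qed.

Let N_gt0 : (0 < N)%N.
Proof. by rewrite N_q muln_gt0 q_gt0 divn_gt0 ?t_le. Qed.

(** The definition of [rho] counts rows, that of [H] counts blocks. The shift is defined on rows,
    and [blk_rho_index] translates it to blocks. *)
Definition rho_index (s : 'I_N) : 'I_N := Ordinal (ltn_pmod (s + q) N_gt0).

Let Rank_val (k : 'I_r) (a : 'I_(p k)) : Rank k a = (S k + a)%N :> nat.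
Proof. by rewrite RankEsum S_ord // ltnW. Qed.

Let shift_cases (k k' : 'I_r) : k' = ((k + t) %% r)%N :> nat ->
  if (k + t < r)%N then k' = (k + t)%N :> nat else (k + t = k' + r)%N.
Proof.
move=> ->; case: ltnP => [lt|le]; first by rewrite modn_small.
have e := subnK le; rewrite -[in RHS]e modnDr modn_small ?e //.
by rewrite ltn_subLR // -addSn leq_add.
Qed.

Lemma rho_index_Rank (k k' : 'I_r) (a : 'I_(p k)) (a' : 'I_(p k')) :
  k' = ((k + t) %% r)%N :> nat -> a = a' :> nat ->
  rho_index (Rank k a) = Rank k' a'.
Proof.
move=> /shift_cases kk' aa'; apply: val_inj.
rewrite -[LHS]/((Rank k a + q) %% N)%N -[RHS]/(nat_of_ord (Rank k' a')).
rewrite Rank_val addnC addnA -SDt aa'; move: kk'.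
case: ltnP => [lt e|le e].
  by rewrite -[in LHS]e -Rank_val modn_small.
by rewrite e SDr -addnA -Rank_val modnDl modn_small.
Qed.

Let blk_next (k : 'I_r) : {k' : 'I_r | k' = ((k + t) %% r)%N :> nat}.
Proof. by exists (Ordinal (ltn_pmod (k + t) r_gt0)). Qed.

Let rho_index_sig (s : 'I_N) (k' : 'I_r) : k' = ((blk s + t) %% r)%N :> nat ->
  exists2 a' : 'I_(p k'), a' = sig2 s :> nat & rho_index s = Rank k' a'.
Proof.
move=> e; have pk : p k' = p (blk s).
  by case: ht => _ _ tp; apply: tp; rewrite e modn_dvdm // modnDr.
exists (cast_ord (esym pk) (sig2 s)) => //.
by rewrite -{1}(sig2K s); apply: rho_index_Rank.
Qed.

Lemma blk_rho_index s : blk (rho_index s) = ((blk s + t) %% r)%N :> nat.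
Proof.
have [k' e] := blk_next (blk s); have [a' _ ->] := rho_index_sig e.
by rewrite Rank1K.
Qed.

Lemma rho_index_inj : injective rho_index.
Proof.
move=> s s' /(congr1 val) /= /eqP; rewrite eqn_modDr !modn_small // => /eqP.
exact: val_inj.
Qed.

Definition wraps (s : 'I_N) := (r <= blk s + t)%N.

Let wrapsE s : wraps s = (N <= s + q)%N.
Proof.
have -> : (s + q = S (blk s + t) + sig2 s)%N.
  by rewrite -{1}[s]sig2K Rank_val SDt addnC addnA.
have [k' e] := blk_next (blk s); have [a' ea _] := rho_index_sig e.
rewrite /wraps -ea; move/shift_cases: e; case: ltnP => [lt e|le e].
  by rewrite -e -Rank_val; apply/esym/negbTE; rewrite -ltnNge.
by rewrite e SDr -addnA leq_addr.
Qed.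

Definition rho_coef s : F := if wraps s then W else 1.

Lemma rho_monomial : rho p t W = monomial_mx rho_index rho_coef.
Proof.
apply/matrixP => m n; rewrite !mxE /rho_coef wrapsE.
have mN : (m < r %/ t * q)%N by rewrite -N_q.
have nN : (n < r %/ t * q)%N by rewrite -N_q.
have -> : (m == rho_index n) = (m == (n + q) %% N :> nat)%N by [].
have qN : (q %| N)%N by rewrite N_q dvdn_mull.
have key1 := divn_shift q_gt0 nN; have key2 := leq_addq_mul q_gt0 nN.
rewrite -N_q in key1 key2.
rewrite (eqn_divmod q m) (modn_dvdm _ qN) modnDr key1 key2.
have ml : (m %/ q < r %/ t)%N by rewrite ltn_divLR.
case: (m %% q =P n %% q)%N => _ /=; last by rewrite andbF.
rewrite andbT; case: (n %/ q =P (r %/ t).-1)%N => [->|_]; last by rewrite andbF.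
rewrite andbT; case: eqP => // e; move: ml; rewrite e ltnNge.
by rewrite prednK ?leqnn // divn_gt0.
Qed.

Lemma rho_coef_unit s : rho_coef s \is a GRing.unit.
Proof.
rewrite /rho_coef; case: ifP => _; last exact: unitr1.
by case: (V) => hF _ _ _; apply: hF; apply: uniformizer_neq0 V.
Qed.

(** This is the invariance of [H] under conjugation by [rho], entry by entry. If both or neither of
    [i], [j] wrap, the order of their blocks is kept; if exactly one wraps, the order is reversed
    and the factor [W] or its inverse compensates. *)
Lemma Hent_rho_index i j x :
  Hent O (rho_index i) (rho_index j) (rho_coef i * x / rho_coef j) <-> Hent O i j x.
Proof.
have Wu : W \is a GRing.unit.
  by case: (V) => hF _ _ _; apply: hF; apply: uniformizer_neq0 V.
have blk_shift (s : 'I_N) : blk (rho_index s) =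
    (if wraps s then blk s + t - r else blk s + t)%N :> nat.
  have [k' e] := blk_next (blk s); rewrite blk_rho_index -e /wraps.
  by have := shift_cases e; case: ltnP => // _ ->; rewrite addnK.
rewrite /Hent !blk_shift /rho_coef.
have := ltn_ord (blk i); have := ltn_ord (blk j).
case wi: (wraps i); case wj: (wraps j); rewrite /wraps in wi wj => ri rj.
- have -> : (blk j + t - r <= blk i + t - r)%N = (blk j <= blk i)%N by lia.
  case: ifP => _; split.
  + by move/(conj_wV V); rewrite -!mulrA mulVr // mulr1 mulKr.
  + exact: (conj_w V).
  + move/(radFPl V) => [a aO e]; apply/(radFPr V); exists a => //.
    by apply: (mulrI Wu); rewrite -[LHS](mulrVK Wu) e mulrA.
  move/(radFPl V) => [a aO ->]; apply/(radFPl V); exists (W * a / W).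
    exact: (conj_w V).
  by rewrite !mulrA.
- have -> : (blk j + t <= blk i + t - r)%N = false by lia.
  have -> : (blk j <= blk i)%N by lia.
  rewrite divr1.
  split=> [/(radFPl V)[a aO /(mulrI Wu) ->] //|xO].
  by apply/(radFPl V); exists x.
- have -> : (blk j + t - r <= blk i + t)%N by lia.
  have -> : (blk j <= blk i)%N = false by lia.
  rewrite mul1r.
  split=> [xO|/(radFPr V)[a aO ->]]; last by rewrite mulrK.
  by apply/(radFPr V); exists (x / W); rewrite ?mulrVK.
by rewrite leq_add2r mul1r divr1.
Qed.

Lemma Ad_rhoP (f : H -> H) : Ad (rho p t W) f <->
  forall x i j, val (f x) (rho_index i) (rho_index j) * rho_coef j =
                rho_coef i * val x i j.
Proof.
rewrite rho_monomial; apply: Ad_monomialP; first exact: rho_index_inj.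
exact: rho_coef_unit.
Qed.

Lemma Ad_rho_exists : exists f : H -> H, Ad (rho p t W) f.
Proof.
have [inv_index invK indexK] := injF_bij rho_index_inj.
pose f (x : H) : H := mkH O (\matrix_(i, j)
  (rho_coef (inv_index i) * val x (inv_index i) (inv_index j)
   / rho_coef (inv_index j))).
exists f; apply/Ad_rhoP => x i j; rewrite mkHK => [|i' j'].
  by rewrite mxE !invK mulrVK // rho_coef_unit.
rewrite -{1}(indexK i') -{1}(indexK j') mxE; apply/Hent_rho_index; exact: Hent_val.
Qed.

Lemma Ad_rho_ring_aut (f : H -> H) : Ad (rho p t W) f -> ring_aut f.
Proof.
move=> fAd; have /Ad_rhoP fE := fAd; have [g [[rg gr] fval]] := fAd; split.
- by move=> x y; apply: val_inj; rewrite fval !val_subH mulrBr mulrBl -!fval.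
- split=> [|x y]; apply: val_inj.
    by rewrite fval !val_oneH mulr1.
  rewrite fval !val_mulH !fval -[RHS]/(_ * _) -[_ *m _]/(_ * _).
  by rewrite !mulrA -(mulrA _ g) gr mulr1.
apply: inj_surj_bij => [x y /(congr1 val)|y].
  rewrite !fval => e; apply: val_inj.
  have {e} : rho p t W * val x = rho p t W * val y.
    by rewrite -[LHS]mulr1 -[RHS]mulr1 -gr !mulrA e.
  by move/(congr1 (fun M => g * M)); rewrite !mulrA gr !mul1r.
pose x : H := mkH O (\matrix_(i, j)
  ((rho_coef i)^-1 * val y (rho_index i) (rho_index j) * rho_coef j)).
exists x; apply: val_inj; apply: (permuted_rows rho_index_inj) => i j.
have [inv_index _ indexK] := injF_bij rho_index_inj; rewrite -(indexK j).
apply: (mulIr (rho_coef_unit (inv_index j))); rewrite fE mkHK => [|k l].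
  by rewrite mxE -mulrA mulVKr // rho_coef_unit.
apply/Hent_rho_index; rewrite mxE !mulrA divrr ?rho_coef_unit // mul1r.
by rewrite mulrK ?rho_coef_unit //; apply: Hent_val.
Qed.

Lemma Ad_rho_hidem (f : H -> H) s : Ad (rho p t W) f ->
  f (hidem O s) = hidem O (rho_index s).
Proof.
move=> /Ad_rhoP fE; apply: val_inj; apply: (permuted_rows rho_index_inj) => i j.
have [inv_index _ indexK] := injF_bij rho_index_inj; rewrite -(indexK j).
apply: (mulIr (rho_coef_unit (inv_index j))); rewrite fE !val_entry_hidem.
rewrite !(inj_eq rho_index_inj).
case: (i =P s) => [->|_] /=; last by rewrite mulr0 mul0r.
by case: eqP => [->|_]; rewrite ?mulr0 ?mul0r ?mulr1 ?mul1r.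
Qed.

End Rho.

(** * Generation of the automorphism group *)

Section Entrywise.
Variables (F : unitRingType) (O : subringClosed F) (w : subring_of O).
Hypothesis V : valuation_order w.
Variables (r : nat) (p : 'I_r -> nat).
Local Notation N := (\sum_i p i)%N.
Local Notation H := (Hord O p).
Local Notation blk := (@sig1 r p).

Definition entry (M : H) s t : subring_of O :=
  SubringOf (Hent_order (Hent_val M s t)).

Lemma val_entry M s t : val (entry M s t) = val M s t.
Proof. by []. Qed.

Variable sigma : subring_of O -> subring_of O.
Hypothesis sigmaA : ring_aut sigma.

Lemma entrywise_exists : exists f : H -> H, entrywise sigma f.
Proof.
exists (fun M => mkH O (\matrix_(s, t) val (sigma (entry M s t)))) => M s t a ea.
rewrite mkHK => [|i j].
  by rewrite mxE (_ : entry M s t = a) //; apply: val_inj.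
rewrite mxE; have := Hent_val M i j; rewrite /Hent; case: ifP => _ => [_|Mr].
  exact: valP.
by rewrite -radF_rad; apply: ring_aut_rad => //; rewrite radF_rad.
Qed.

Variable f : H -> H.
Hypothesis fE : entrywise sigma f.

Lemma entry_entrywise M s t : entry (f M) s t = sigma (entry M s t).
Proof. by apply: val_inj; rewrite val_entry; apply: fE. Qed.

Lemma entry_inj (M M' : H) : (forall s t, entry M s t = entry M' s t) -> M = M'.
Proof. by move=> e; apply: H_eqP => s t; rewrite -!val_entry e. Qed.

Lemma entrywise_morphism : zmod_morphism f /\ monoid_morphism f.
Proof.
have entryB (M M' : H) s t : entry (M - M') s t = entry M s t - entry M' s t.
  by apply: val_inj; rewrite valOB !val_entry val_entryB.
split.
  move=> M M'; apply: entry_inj => s t.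
  by rewrite entryB !entry_entrywise entryB (ring_autB sigmaA).
split=> [|M M']; apply: entry_inj => s t; rewrite !entry_entrywise.
  have -> : entry 1 s t = (s == t)%:R.
    by apply: val_inj; rewrite val_entry val_entry1 rmorph_nat.
  by case: eqP => _; rewrite ?(ring_aut1 sigmaA) ?(ring_aut0 sigmaA).
have entryM (K K' : H) : entry (K * K') s t = \sum_k entry K s k * entry K' k t.
  apply: val_inj; rewrite val_entry val_entryM.
  have -> : val (\sum_k entry K s k * entry K' k t) =
    \sum_k val (entry K s k * entry K' k t) by exact: rmorph_sum.
  by apply: eq_bigr => k _; rewrite valOM !val_entry.
rewrite !entryM (big_morph sigma (ring_autD sigmaA) (ring_aut0 sigmaA)).
by apply: eq_bigr => k _; rewrite (ring_autM sigmaA) !entry_entrywise.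
Qed.

End Entrywise.

Section EntrywiseAut.
Variables (F : unitRingType) (O : subringClosed F) (w : subring_of O).
Hypothesis V : valuation_order w.
Variables (r : nat) (p : 'I_r -> nat).
Local Notation N := (\sum_i p i)%N.
Local Notation H := (Hord O p).
Local Notation blk := (@sig1 r p).
Local Notation W := (val w).

Lemma entrywise_ring_aut sigma (f : H -> H) :
  ring_aut sigma -> entrywise sigma f -> ring_aut f.
Proof.
move=> sigmaA fE; have [fB fM] := entrywise_morphism sigmaA fE; split=> //.
have [_ _ [tau sK tK]] := sigmaA; have tauA := ring_aut_inv sigmaA sK tK.
have [g gE] := @entrywise_exists _ _ _ p _ tauA.
have efE := entry_entrywise fE; have egE := entry_entrywise gE.
by exists g => M; apply: entry_inj => s t; rewrite !(egE, efE) ?sK ?tK.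
Qed.

Lemma induced_entrywise sigma (f : H -> H) y i :
    ring_aut sigma -> entrywise sigma f ->
  theta (induced f y) i = map_mx (induced sigma) (theta y i).
Proof.
move=> sigmaA fE; rewrite -[y]modrad_repr induced_modrad; last first.
  exact: entrywise_ring_aut fE.
rewrite !(theta_modrad V); apply/matrixP => a b; rewrite [RHS]mxE !diag_residueE.
by rewrite -!val_entry (entry_entrywise fE) /residue !valKd induced_modrad.
Qed.

Hypotheses (r_gt0 : (0 < r)%N) (hp : forall i, (0 < p i)%N).
Variable t : nat.
Hypothesis ht : minimal_period p t.

Definition aut_generators : set (H -> H) :=
  [set g | [\/ inner g, exists2 sigma, ring_aut sigma & entrywise sigma g
                      | Ad (rho p t W) g]].

Let per : period p t. Proof. by case: ht. Qed.

Lemma generated_ring_aut f : generated aut_generators f -> ring_aut f.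
Proof.
elim=> [|{}f []|{}f g _ IHf _ IHg|{}f g _ IHf fK gK].
- exact: ring_aut_id.
- exact: inner_ring_aut.
- by case=> sigma; apply: entrywise_ring_aut.
- exact: (Ad_rho_ring_aut V r_gt0 hp per).
- exact: ring_aut_comp.
exact: ring_aut_inv fK gK.
Qed.

Let s0 : 'I_N := Rank (Ordinal r_gt0) (Ordinal (hp (Ordinal r_gt0))).

Let s0_min s : (blk s0 <= blk s)%N.
Proof. by rewrite Rank1K. Qed.

(** When [pi] fixes the blocks, each [u s] has valuation 0. The monomial matrix with coefficients
    [u] is then a unit of [H], and [f] is an entrywise automorphism followed by an inner one. *)
Lemma block_preserving_generated f (pi : 'I_N -> 'I_N) : ring_aut f ->
    (forall s, f (hidem O s) = hidem O (pi s)) ->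
    (forall s, blk (pi s) = blk s) ->
  generated aut_generators f.
Proof.
move=> fA fh pi_blk; have pi_inj := permutation_inj fA fh.
have [sigma sigmaA [u [fE uval _]]] := monomial_form V fA fh s0_min.
have uU s : ounit O (u s).
  have [c uc ->] := uval s; rewrite !pi_blk ltnNge s0_min.
  by rewrite mul1r.
have uu s : u s \is a GRing.unit by exact: (ounit_unit V (uU s)).
have [g gE] := @entrywise_exists _ _ _ p _ sigmaA.
have [e1 e2] := monomial_mulV pi_inj uu.
have Hmono c i j : (forall s, c s \in O) -> Hent O i j (monomial_mx pi c i j).
  move=> cO; rewrite mxE; case: eqP => [->|_]; last by apply/Hent_rad/radF0.
  by rewrite /Hent pi_blk leqnn.
have Hmono' i j : Hent O i j (monomial_inv pi u i j).
  rewrite mxE; case: eqP => [->|_]; last by apply/Hent_rad/radF0.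
  by rewrite /Hent pi_blk leqnn; case/and3P: (uU i).
pose G : H := mkH O (monomial_mx pi u); pose G' : H := mkH O (monomial_inv pi u).
have vG : val G = monomial_mx pi u.
  by apply: mkHK => i j; apply: Hmono => s; apply: ounit_order (uU s).
have vG' : val G' = monomial_inv pi u by apply: mkHK.
have -> : f = (fun x => G * x * G') \o g.
  apply: functional_extensionality_dep => x /=; apply: val_inj.
  rewrite !val_mulH vG vG' -[LHS]mulr1 -e1 [LHS]mulrA; congr (_ * _).
  apply: (permuted_rows pi_inj) => i j; rewrite [LHS]mul_mx_monomial.
  rewrite [RHS](mul_monomial_mx _ pi_inj) (fE _ _ _ (entry x i j)) //.
  by rewrite -(entry_entrywise gE).
apply: gen_comp; apply: gen_mem.
  apply: Or31; exists G, G'; split=> //.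
  by split; apply: val_inj; rewrite val_mulH vG vG' val_oneH ?[LHS]e1 ?[LHS]e2.
by apply: Or32; exists sigma.
Qed.

Lemma rotation_generated k f (pi : 'I_N -> 'I_N) : ring_aut f ->
    (forall s, f (hidem O s) = hidem O (pi s)) ->
    (forall s, blk (pi s) = ((blk s + k * t) %% r)%N :> nat) ->
  generated aut_generators f.
Proof.
elim: k f pi => [|k IH] f pi fA fh pi_blk.
  apply: (block_preserving_generated fA fh) => s.
  by apply: val_inj; rewrite /= pi_blk addn0 modn_small.
have [h hAd] := Ad_rho_exists V r_gt0 hp per.
have hA := Ad_rho_ring_aut V r_gt0 hp per hAd.
have [_ _ [g hK gK]] := hA; have gA := ring_aut_inv hA hK gK.
pose tau := rho_index r_gt0 hp per.
have [tau' _ tauK] : bijective tau by apply: injF_bij; apply: rho_index_inj.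
have -> : f = h \o (g \o f).
  by apply: functional_extensionality_dep => x /=; rewrite gK.
apply: gen_comp; first by apply: gen_mem; apply: Or33.
apply: (IH _ (tau' \o pi)) => [|s|s]; first exact: ring_aut_comp.
  apply: (can_inj hK); rewrite /= gK fh -[pi s in LHS]tauK.
  by rewrite (Ad_rho_hidem V r_gt0 hp per).
have := pi_blk s; rewrite -[pi s]tauK blk_rho_index mulSn [(t + _)%N]addnC.
by move/eqP; rewrite addnA eqn_modDr modn_small // => /eqP.
Qed.

Lemma ring_aut_generated f : ring_aut f <-> generated aut_generators f.
Proof.
split=> [fA|]; last exact: generated_ring_aut.
have [u [v [pi [[uv vu] uE]]]] := ring_aut_permutes_hidem V fA.
pose h x := u * f x * v.
have hA : ring_aut h.
  apply: (ring_aut_comp (f := fun x => u * x * v)) => //.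
  by apply: inner_ring_aut; exists u, v.
have -> : f = (fun x => v * x * u) \o h.
  apply: functional_extensionality_dep => x /=.
  by rewrite /h !mulrA vu mul1r -mulrA vu mulr1.
apply: gen_comp; first by apply: gen_mem; apply: Or31; exists v, u.
have pi_inj := permutation_inj hA uE.
have [_ _ [_ [_ _ pi_blk]]] := monomial_form V hA uE s0_min.
have /dvdnP[k ek] := block_rotation_period hp pi_inj pi_blk r_gt0 ht.
apply: (rotation_generated (k := k) hA uE) => s.
by rewrite -ek; apply: (block_rotation hp pi_blk).
Qed.

End EntrywiseAut.

(** * Induced automorphisms *)

Section InducedInner.
Variables (F : unitRingType) (O : subringClosed F) (w : subring_of O).
Hypothesis V : valuation_order w.
Variables (r : nat) (p : 'I_r -> nat).
Local Notation H := (Hord O p).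

(** Both [x * y] and [y * x] are 1 modulo the radical, hence invertible; the resulting right inverse
    [y * c] and left inverse [d * y] of [x] coincide. *)
Lemma modrad_unit_lift (x y : H) : mutual_inverse (modrad x) (modrad y) ->
  exists2 x', mutual_inverse x x' & modrad x' = modrad y.
Proof.
move=> [xy yx].
have lift (a b : H) : modrad a * modrad b = 1 -> invertible (a * b).
  move=> ab; have /modrad_eq/(rad_sub1_invertible V) : modrad 1 = modrad (a * b).
    by rewrite modradM.
  by rewrite opprB addrC subrK.
have [c [xyc cxy]] := lift _ _ xy; have [d [yxd dyx]] := lift _ _ yx.
exists (y * c).
  split; first by rewrite mulrA.
  have -> : y * c = d * y.
    by rewrite -[LHS]mul1r -dyx -!mulrA (mulrA x) xyc mulr1.
  by rewrite -mulrA.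
rewrite modradM -[rad_quot_mul _ _]/(modrad y * modrad c).
have e : modrad c = 1.
  rewrite -[LHS]mul1r -[in LHS]xy -[modrad x * modrad y]modradM.
  by rewrite -[LHS]modradM xyc.
by rewrite e mulr1.
Qed.

Lemma induced_inner (g : rad_quot H -> rad_quot H) :
  (exists2 f : H -> H, inner f & g = induced f) <-> inner g.
Proof.
split=> [[f [u [v [[uv vu] fE]]] ->]|[u [v [uv gE]]]].
  exists (modrad u), (modrad v); split.
    by split; rewrite -[LHS]modradM ?uv ?vu.
  move=> y; rewrite -{2}[y]modrad_repr /induced fE !modradM //.
have [v' uv' ev] : exists2 v', mutual_inverse (repr u) v' &
    modrad v' = modrad (repr v).
  by apply: modrad_unit_lift; rewrite !modrad_repr.
exists (fun x => repr u * x * v'); first by exists (repr u), v'.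
apply: functional_extensionality_dep => y; rewrite gE /induced !modradM ev.
by rewrite !modrad_repr.
Qed.

End InducedInner.

Lemma conform_mx_square (T : Type) m n (e : m = n) (B : 'M[T]_n) (A : 'M[T]_m) a b :
  conform_mx B A a b = A (cast_ord (esym e) a) (cast_ord (esym e) b).
Proof.
by move: B a b; case: _ / e => B a b; rewrite conform_mx_id !cast_ord_id.
Qed.

Section TwistedShift.
Variables (F : unitRingType) (O : subringClosed F) (w : subring_of O).
Hypothesis V : valuation_order w.
Variables (r : nat) (p : 'I_r -> nat).
Local Notation N := (\sum_i p i)%N.
Local Notation H := (Hord O p).
Local Notation blk := (@sig1 r p).
Local Notation W := (val w).
Hypotheses (r_gt0 : (0 < r)%N) (hp : forall i, (0 < p i)%N).
Variable t : nat.
Hypothesis ht : period p t.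

Let Wu : W \is a GRing.unit.
Proof. by case: (V) => hF _ _ _; apply: hF; apply: uniformizer_neq0 V. Qed.

Definition conj_uniformizer (a : subring_of O) : subring_of O :=
  SubringOf (conj_w V (valP a)).

Lemma conj_uniformizer_Ad : Ad W conj_uniformizer.
Proof. by exists W^-1; split=> //; split; rewrite ?divrr ?mulVr. Qed.

Lemma val_conj_uniformizer a : val (conj_uniformizer a) = W * val a / W.
Proof. by []. Qed.

Lemma conj_uniformizer_ring_aut : ring_aut conj_uniformizer.
Proof.
have cE := val_conj_uniformizer; split.
- by move=> x y; apply: val_inj; rewrite valOB !cE valOB mulrBr mulrBl.
- split; first by apply: val_inj; rewrite cE [val 1]rmorph1 mulr1 divrr.
  by move=> x y; apply: val_inj; rewrite valOM !cE valOM !mulrA mulrVK.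
apply: inj_surj_bij => [x y /(congr1 val)|y].
  by rewrite !cE => /(divIr Wu)/(mulrI Wu); apply: val_inj.
exists (SubringOf (conj_wV V (valP y))); apply: val_inj; rewrite cE /=.
by rewrite !mulrA divrr // mul1r mulrK.
Qed.

Definition kappa_of := induced conj_uniformizer.

Lemma kappa_ofP : is_kappa w kappa_of.
Proof.
exists conj_uniformizer; split=> //.
- exact: conj_uniformizer_ring_aut.
exact: conj_uniformizer_Ad.
Qed.

Lemma kappa_of_residue x :
  x \in O -> kappa_of (residue O x) = residue O (W * x / W).
Proof.
move=> xO; rewrite /residue /kappa_of induced_modrad; last first.
  exact: conj_uniformizer_ring_aut.
congr modrad; apply: val_inj; rewrite val_conj_uniformizer !insubdK //.
exact: (conj_w V).
Qed.

Lemma induced_Ad_rho (f : H -> H) y : Ad (rho p t W) f ->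
  theta (induced f y) = twisted_shift t kappa_of (theta y).
Proof.
move=> fAd; have fA := Ad_rho_ring_aut V r_gt0 hp ht fAd.
have /(Ad_rhoP V r_gt0 hp ht) fE := fAd.
have [t0 tr tp] := ht; have le_tr : (t <= r)%N by rewrite dvdn_leq.
rewrite -[y]modrad_repr induced_modrad // !(theta_modrad V).
move: (repr y) => {y} x.
apply: functional_extensionality_dep => i; apply/matrixP => a b.
(* [k] is the block that [rho] carries to block [i]; the equality of sizes [pk] turns [conform_mx]
   into a cast. *)
set k := shift_index t i.
have ik : i = ((k + t) %% r)%N :> nat.
  by rewrite /= modnDml -addnA subnK // modnDr modn_small.
have pk : p k = p i by apply: tp; rewrite [in RHS]ik modn_dvdm // modnDr.
pose a' := cast_ord (esym pk) a; pose b' := cast_ord (esym pk) b.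
have ea : rho_index r_gt0 hp ht (Rank k a') = Rank i a by apply: rho_index_Rank.
have eb : rho_index r_gt0 hp ht (Rank k b') = Rank i b by apply: rho_index_Rank.
(* The factor [w] occurs exactly where the shift wraps, that is, over the first [t] blocks of the
   image; conjugation by it becomes [kappa] on residues. *)
have wr c : wraps t (Rank k c) = (i < t)%N.
  rewrite /wraps Rank1K /=; case: (ltnP i t) => [lt|le].
    by rewrite modn_small ?addnBA // ?leq_subLR; lia.
  by rewrite -(subnK le) -addnA subnKC // modnDr modn_small; lia.
rewrite diag_residueE -ea -eb.
have -> : val (f x) (rho_index r_gt0 hp ht (Rank k a'))
                    (rho_index r_gt0 hp ht (Rank k b')) =
  (if (i < t)%N then W * val x (Rank k a') (Rank k b') / W
   else val x (Rank k a') (Rank k b')).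
  have := fE x (Rank k a') (Rank k b'); rewrite /rho_coef !wr; case: ifP => _.
    by move=> /(congr1 (fun z => z / W)); rewrite mulrK.
  by rewrite mulr1 mul1r.
rewrite /twisted_shift -/k.
case: ifP => _; rewrite ?mxE (conform_mx_square pk) diag_residueE //.
by rewrite kappa_of_residue //; apply: Hent_order (Hent_val _ _ _).
Qed.

End TwistedShift.

(** * Dependence on the uniformizing element *)

Section ChangeUniformizer.
Variables (F : unitRingType) (O : subringClosed F) (w w' : subring_of O).
Hypothesis V : valuation_order w.
Hypothesis hw' : uniformizer w'.

Lemma uniformizer_change : exists2 u, invertible u & w' = u * w.
Proof.
have [hF hloc hnu hw] := V.
have w0 := uniformizer_neq0 V.
have w0' : val w' != 0 by apply: uniformizer_neq0; split.
have mul1K (c v : subring_of O) : val v != 0 -> v = c * v -> c = 1.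
  move=> v0 e; apply: val_inj; apply: (mulIr (hF _ v0)).
  by rewrite -valOM -e [val 1]rmorph1 mul1r.
have [u eu] := (hw w').2.1 ((hw' w').2.2 (ex_intro _ 1 (esym (mul1r _)))).
have [b eb] := (hw' w).2.1 ((hw w).2.2 (ex_intro _ 1 (esym (mul1r _)))).
exists u => //; exists b; split.
  by apply: (mul1K _ w') => //; rewrite -mulrA -eb.
by apply: (mul1K _ w) => //; rewrite -mulrA -eu.
Qed.

Lemma twisted_shift_change (r : nat) (p : 'I_r -> nat) t
    (kappa kappa' : Obar O -> Obar O) :
    is_kappa w kappa -> is_kappa w' kappa' ->
  exists2 g : block_prod (Obar O) p -> block_prod (Obar O) p, inner g &
    forall z, twisted_shift t kappa' z = g (twisted_shift t kappa z).
Proof.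
move=> [f [fA [g [[wg gw] fE]] ->]] [f' [f'A [g' [[wg' gw'] fE']] ->]].
have [u [v [uv vu]] eu] := uniformizer_change.
(* Conjugation by [w' = u * w] is conjugation by [w] followed by conjugation by [u]. *)
have ff a : f' a = u * f a * v.
  apply: val_inj; rewrite !valOM fE fE' eu valOM.
  suff -> : g' = g * val v by rewrite !mulrA.
  have e : g * val v * val w' = 1.
    by rewrite eu valOM !mulrA -(mulrA g) -valOM vu [val 1]rmorph1 mulr1.
  by rewrite -[LHS]mul1r -e -mulrA wg' mulr1.
pose ub : Obar O := modrad u; pose vb : Obar O := modrad v.
have uvb : ub * vb = 1 by rewrite -[LHS]modradM uv.
have vub : vb * ub = 1 by rewrite -[LHS]modradM vu.
have kk y : induced f' y = ub * induced f y * vb.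
  by rewrite /induced ff !modradM.
(* The conjugating element is the scalar residue of [u] on the first [t] blocks, those to which
   [twisted_shift] applies [kappa], and 1 on the others. *)
pose U (c : Obar O) : block_prod (Obar O) p :=
  fun i => if (i < t)%N then c%:M else 1%:M.
have UM c d : c * d = 1 -> U c * U d = 1.
  move=> cd; apply: functional_extensionality_dep => i.
  rewrite -[LHS]/(U c i *m U d i) -[RHS]/(1%:M) /U; case: ifP => _.
    by rewrite -scalar_mxM cd.
  by rewrite mul1mx.
exists (fun z => U ub * z * U vb).
  by exists (U ub), (U vb); split=> //; split; apply: UM.
move=> z; apply: functional_extensionality_dep => i.
rewrite -[RHS]/(U ub i *m _ *m U vb i) /U /twisted_shift.
case: ifP => _; last first.
  by rewrite mul1mx mulmx1.
apply/matrixP => a b; rewrite mul_scalar_mx [RHS]mxE (bigD1 b) //=.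
rewrite [X in _ + X]big1 ?addr0 => [|c cb]; last by rewrite !mxE (negPf cb) mulr0.
by rewrite !mxE eqxx kk.
Qed.

End ChangeUniformizer.


Theorem corollary3p8
  (R : idomainType) (hR : discrete_valuation_ring R) (cR : adically_complete R)
  (K : fieldType) (iota : {rmorphism R -> K}) (hK : quotient_field iota)
  (F : falgType K) (hF : skew_field F) (hZ : ('Z({:F}) = 1)%VS)
  (O : subringClosed F) (hO : maximal_order iota O)
  (w : subring_of O) (hw : uniformizer w)
  (r : nat) (hr : (0 < r)%N) (p : 'I_r -> nat) (hp : forall i, (0 < p i)%N)
  (t : nat) (ht : minimal_period p t) :
  (* the isomorphism of H / rad H with the product of the M_{p_i}(O / rad O) *)
  [/\ forall x : Hord O p, theta (modrad x) = diag_residue x,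
      zmod_morphism (@theta F O r p), monoid_morphism (@theta F O r p)
    & bijective (@theta F O r p)] /\
  (* the classes (b) and (c) are well defined *)
  (forall sigma, ring_aut sigma -> exists f : Hord O p -> Hord O p, entrywise sigma f) /\
  (exists f : Hord O p -> Hord O p, Ad (rho p t (val w)) f) /\
  (* generation of Aut(H) *)
  (forall f : Hord O p -> Hord O p,
     ring_aut f <->
     generated [set g | [\/ inner g,
                            exists2 sigma, ring_aut sigma & entrywise sigma g
                          | Ad (rho p t (val w)) g]] f) /\
  (* induced automorphisms, (a) *)
  (forall g : rad_quot (Hord O p) -> rad_quot (Hord O p),
     (exists2 f, inner f & g = induced f) <-> inner g) /\
  (* induced automorphisms, (b) *)
  (forall g : rad_quot (Hord O p) -> rad_quot (Hord O p),
     (exists f, (exists2 sigma, ring_aut sigma & entrywise sigma f) /\ g = induced f) <->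
     (exists tau, (exists2 sigma : subring_of O -> subring_of O,
                     ring_aut sigma & tau = induced sigma) /\
                  forall y i, theta (g y) i = map_mx tau (theta y i))) /\
  (* induced automorphisms, (c) *)
  (exists2 kappa, is_kappa w kappa &
     forall f, Ad (rho p t (val w)) f ->
     forall y, theta (induced f y) = twisted_shift t kappa (theta y)) /\
  (* change of the uniformizing element *)
  (forall w' : subring_of O, uniformizer w' ->
     (exists2 u, invertible u & w' = u * w) /\
     forall kappa kappa', is_kappa w kappa -> is_kappa w' kappa' ->
       exists2 g : block_prod (Obar O) p -> block_prod (Obar O) p, inner g &
         forall z, twisted_shift t kappa' z = g (twisted_shift t kappa z)).
Proof.
have V : valuation_order w.
  split=> //; last by case: (order_nonunit hR hK hO.1) => x ? ?; exists x.
  by move=> x xO; apply: (order_local hR cR hK hF hO.1).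
have per : period p t by case: ht.
split; first split.
- exact: (theta_modrad V).
- exact: (theta_zmod V).
- exact: (theta_monoid V).
- exact: (theta_bij V).
split; first by move=> sigma sigmaA; apply: (entrywise_exists p sigmaA).
split; first exact: (Ad_rho_exists V hr hp per).
split; first exact: (ring_aut_generated V hr hp ht).
split; first exact: (induced_inner V).
split.
  move=> g; split=> [[f [[sigma sigmaA fE] ->]]|[tau [[sigma sigmaA ->] gE]]].
    exists (induced sigma); split; first by exists sigma.
    by move=> y i; apply: (induced_entrywise V).
  have [f fE] := entrywise_exists p sigmaA.
  exists f; split; first by exists sigma.
  apply: functional_extensionality_dep => y; apply: (theta_inj V).
  apply: functional_extensionality_dep => i.
  by rewrite gE (induced_entrywise V _ _ sigmaA fE).
split.
  exists (kappa_of V); first exact: kappa_ofP.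
  by move=> f fAd y; apply: (induced_Ad_rho V hr hp per).
move=> w' hw'; split; first exact: (uniformizer_change V hw').
by move=> kappa kappa'; apply: (twisted_shift_change V hw').
Qed.
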